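(* Let $\mathfrak k\subset\mathfrak{gl}(V,V_* )$ be any subalgebra. Then there exists a taut couple $\mathfrak F,\mathfrak G$ with $\mathfrak k\subset\mathrm{St}_{\mathfrak F}\cap\mathrm{St}_{\mathfrak G}$ such that for every $\gamma\in C$ the quotients $F''_\gamma/F'_\gamma$ and $G''_\gamma/G'_\gamma$ are irreducible $\mathfrak k$-modules, and moreover $$\mathfrak n_{\mathfrak k}=\mathfrak n_{\mathrm{St}_{\mathfrak F}\cap\mathrm{St}_{\mathfrak G}}\cap\mathfrak k.$$
   Context: $V,V_*$: countable-dimensional complex spaces with nondegenerate pairing; $\mathfrak{gl}(V,V_* )=V\otimes V_*$ (Lie algebra of the associative algebra with $(v\otimes w)(v'\otimes w')=\langle v',w\rangle v\otimes w'$), acting on $V$ by $(v\otimes w)u=\langle u,w\rangle v$ and on $V_*$ by $(v\otimes w)y=-\langle v,y\rangle w$. Orthogonal complement $F^\perp$; closed: $F=F^{\perp\perp}$; $\overline F=F^{\perp\perp}$. Generalized flag: chain of subspaces, every member in an immediate predecessor–successor pair $F'\subsetneq F''$, every nonzero vector in $F''\setminus F'$ for some pair; pairs of $\mathfrak F$ indexed by $A$, of $\mathfrak G$ by $B$. Semiclosed: $\overline{F'}\in\{F',F''\}$ for every pair. $\mathrm{St}$ = stabilizer in $\mathfrak{gl}(V,V_* )$. Taut couple: semiclosed $\mathfrak F$ in $V$, $\mathfrak G$ in $V_*$ with $\mathfrak F^\perp$ stable under $\mathrm{St}_{\mathfrak G}$ and $\mathfrak G^\perp$ stable under $\mathrm{St}_{\mathfrak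 F}$. For a taut couple, the pairs $\alpha$ of $\mathfrak F$ with $F'_\alpha$ closed are in bijection with the pairs $\beta$ of $\mathfrak G$ with $G'_\beta$ closed via $G'_\beta=(F''_\alpha)^\perp$ (then also $(G''_\beta)^\perp=F'_\alpha$); this common index set is $C$, with corresponding pairs written $F'_\gamma\subset F''_\gamma$, $G'_\gamma\subset G''_\gamma$. Linear nilradical $\mathfrak n_{\mathfrak k}$ of $\mathfrak k\subset\mathfrak{gl}(V,V_* )$: elements of the largest locally solvable ideal of $\mathfrak k$ that are nilpotent endomorphisms of $V$. *)

(* Defs.v *)
From HB Require Import structures.
From mathcomp Require Import all_boot all_order all_algebra.
Set Implicit Arguments. Unset Strict Implicit. Unset Printing Implicit Defensive.
Import Order.TTheory GRing.Theory Num.Theory.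
Local Open Scope ring_scope.

Section Defs.
Variable K : fieldType.

Definition incl (T : Type) (A B : T -> Prop) := forall x, A x -> B x.
Definition seteq (T : Type) (A B : T -> Prop) := forall x, A x <-> B x.
Definition sincl (T : Type) (A B : T -> Prop) := incl A B /\ ~ incl B A.

Definition subspace (T : lmodType K) (S : T -> Prop) :=
  S 0 /\ (forall a x y, S x -> S y -> S (a *: x + y)).

Definition countable_dim (T : lmodType K) :=
  exists e : nat -> T, forall v, exists (n : nat) (c : nat -> K),
    v = \sum_(i < n) c i *: e i.

Variables (V W : lmodType K) (p : V -> W -> K).

Definition perpV (A : V -> Prop) : W -> Prop := fun y => forall v, A v -> p v y = 0.
Definition perpW (B : W -> Prop) : V -> Prop := fun v => forall y, B y -> p v y = 0.
Definition closedV (A : V -> Prop) := seteq (perpW (perpV A)) A.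
Definition closedW (B : W -> Prop) := seteq (perpV (perpW B)) B.

Definition isPair (T : Type) (Fl : (T -> Prop) -> Prop) (F1 F2 : T -> Prop) :=
  [/\ Fl F1, Fl F2, sincl F1 F2 & forall H, Fl H -> incl H F1 \/ incl F2 H].

Definition genFlag (T : lmodType K) (Fl : (T -> Prop) -> Prop) :=
  [/\ forall F, Fl F -> subspace F,
      forall F1 F2, Fl F1 -> Fl F2 -> incl F1 F2 \/ incl F2 F1,
      forall F, Fl F -> exists F1 F2, isPair Fl F1 F2 /\ (seteq F F1 \/ seteq F F2)
    & forall v, v <> 0 -> exists F1 F2, isPair Fl F1 F2 /\ F2 v /\ ~ F1 v].

Definition semiclosedV (Fl : (V -> Prop) -> Prop) :=
  genFlag Fl /\ forall F1 F2, isPair Fl F1 F2 ->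
    seteq (perpW (perpV F1)) F1 \/ seteq (perpW (perpV F1)) F2.
Definition semiclosedW (Gl : (W -> Prop) -> Prop) :=
  genFlag Gl /\ forall G1 G2, isPair Gl G1 G2 ->
    seteq (perpV (perpW G1)) G1 \/ seteq (perpV (perpW G1)) G2.

(* ---------- gl(V,V_* ) = V (x) V_*, realised through its faithful action on V ---------- *)
Definition End := V -> V.
(* f is (the action on V of) a finite sum  sum_i v_i (x) w_i : u |-> sum_i <u,w_i> v_i *)
Definition inGl (f : End) :=
  exists s : seq (V * W), forall u, f u = \sum_(x <- s) p u x.2 *: x.1.
(* action on V_* : (v (x) w) y = - <v,y> w ; z = f.y  iff  <u,z> = - <f u, y> for all u *)
Definition starAct (f : End) (y z : W) := forall u, p u z = - p (f u) y.

Definition stabV (f : End) (A : V -> Prop) := forall u, A u -> A (f u).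
Definition stabW (f : End) (B : W -> Prop) := forall y z, B y -> starAct f y z -> B z.

Definition StV (Fl : (V -> Prop) -> Prop) (f : End) := inGl f /\ forall F, Fl F -> stabV f F.
Definition StW (Gl : (W -> Prop) -> Prop) (f : End) := inGl f /\ forall G, Gl G -> stabW f G.

Definition taut (Fl : (V -> Prop) -> Prop) (Gl : (W -> Prop) -> Prop) :=
  [/\ semiclosedV Fl, semiclosedW Gl,
      (forall f, StW Gl f -> forall F, Fl F -> stabW f (perpV F))
    & (forall f, StV Fl f -> forall G, Gl G -> stabV f (perpW G))].

Definition zeroE : End := fun _ => 0.
Definition addE (f g : End) : End := fun u => f u + g u.
Definition scaleE (a : K) (f : End) : End := fun u => a *: f u.
Definition bracket (f g : End) : End := fun u => f (g u) - g (f u).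

Definition subspaceE (S : End -> Prop) :=
  S zeroE /\ forall a f g, S f -> S g -> S (addE (scaleE a f) g).
Definition lieSub (S : End -> Prop) :=
  subspaceE S /\ forall f g, S f -> S g -> S (bracket f g).
Definition subalg (k : End -> Prop) := incl k inGl /\ lieSub k.
Definition ideal (L I : End -> Prop) :=
  [/\ incl I L, subspaceE I & forall x y, L x -> I y -> I (bracket x y)].

Definition genAlg (n : nat) (g : nat -> End) (f : End) :=
  forall T, lieSub T -> (forall i, (i < n)%N -> T (g i)) -> T f.
Definition derived (S : End -> Prop) (f : End) :=
  forall T, subspaceE T -> (forall x y, S x -> S y -> T (bracket x y)) -> T f.
Definition solvableE (S : End -> Prop) :=
  exists n, forall f, iter n derived S f -> f = zeroE.
Definition locSolv (S : End -> Prop) :=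
  forall n (g : nat -> End), (forall i, (i < n)%N -> S (g i)) -> solvableE (genAlg n g).
Definition largestLS (L R : End -> Prop) :=
  [/\ ideal L R, locSolv R & forall I, ideal L I -> locSolv I -> incl I R].

Definition nilpEnd (f : End) := exists n, forall u, iter n f u = 0.

Definition irredV (k : End -> Prop) (F1 F2 : V -> Prop) :=
  [/\ sincl F1 F2, (forall f, k f -> stabV f F1 /\ stabV f F2)
    & forall M, subspace M -> incl F1 M -> incl M F2 -> (forall f, k f -> stabV f M) ->
        seteq M F1 \/ seteq M F2].
Definition irredW (k : End -> Prop) (G1 G2 : W -> Prop) :=
  [/\ sincl G1 G2, (forall f, k f -> stabW f G1 /\ stabW f G2)
    & forall M, subspace M -> incl G1 M -> incl M G2 -> (forall f, k f -> stabW f M) ->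
        seteq M G1 \/ seteq M G2].

End Defs.

(* Main.v *)
Require Import Defs.
From HB Require Import structures.
From mathcomp Require Import all_boot all_order all_algebra.
From mathcomp Require Import boolp classical_sets.
From mathcomp Require Import ring spectral.
Set Implicit Arguments. Unset Strict Implicit. Unset Printing Implicit Defensive.
Import Order.TTheory GRing.Theory Num.Theory.
Local Open Scope ring_scope.

(**
  Take a maximal chain C of closed k-stable subspaces of V; the perpendiculars of its members form
  such a chain in V_*. A vector v lies in the gap between the union F' of the members of C
  avoiding v and the intersection F'' of those containing v. If F' is closed, F''/F' has no proper
  nonzero closed k-submodule, hence by finite rank a smallest nonzero submodule M/F', and M is dense
  in F''; inserting these M into the chain yields a semiclosed generalized flag whose quotients over
  closed F' are irreducible. Tautness holds because the perpendicular of a member of one flag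
  belongs, by maximality, to the chain that generates the other flag.

  Let N be the set of f in the stabilizer of both flags with f F'' in F' whenever F' is closed.
  Finite rank gives f F'' in F' also for the pairs with F' dense in F'', so N is a
  locally solvable ideal: finitely many of its elements act strictly triangularly on a
  finite-dimensional space. Conversely, a nilpotent element f of a locally solvable ideal of a
  finitary Lie algebra L acts by zero on every irreducible section X of L: if f x <> 0, then x is
  obtained from f x by finitely many elements of L, so f would act nontrivially on a
  finite-dimensional section irreducible under a subalgebra of L, where a solvable ideal acts by
  scalars and a nilpotent scalar is zero. Both nilradicals intersected with k therefore equal the
  intersection of N and k.
*)

(** * Finite-dimensional sections *)

Section Subspaces.
Variables (K : fieldType) (T : lmodType K).
Implicit Types (A B : T -> Prop).

Lemma subspaceD A x y : subspace A -> A x -> A y -> A (x + y).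
Proof. by move=> [_ h] Ax Ay; rewrite -[x]scale1r; apply: h. Qed.
Lemma subspaceZ A a x : subspace A -> A x -> A (a *: x).
Proof. by move=> [h0 h] Ax; rewrite -[_ *: _]addr0; apply: h. Qed.
Lemma subspaceN A x : subspace A -> A x -> A (- x).
Proof. by move=> sA Ax; rewrite -scaleN1r; apply: subspaceZ. Qed.
Lemma subspaceB A x y : subspace A -> A x -> A y -> A (x - y).
Proof. by move=> sA Ax Ay; apply: subspaceD => //; apply: subspaceN. Qed.
Lemma subspaceBr A x y : subspace A -> A y -> A (x - y) -> A x.
Proof. by move=> sA Ay Axy; rewrite -(subrK y x); apply: subspaceD. Qed.
Lemma subspace_sum A (I : finType) (F : I -> T) :
  subspace A -> (forall i, A (F i)) -> A (\sum_i F i).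
Proof.
move=> sA AF; apply: (big_ind A) => //; first by case: sA.
by move=> x y; apply: subspaceD.
Qed.

Definition span_fam (I : finType) (e : I -> T) (u : T) :=
  exists c : I -> K, u = \sum_i c i *: e i.

Lemma span_fam_subspace (I : finType) (e : I -> T) : subspace (span_fam e).
Proof.
split; first by exists (fun=> 0); rewrite big1 // => i _; rewrite scale0r.
move=> a x y [c ->] [d ->]; exists (fun i => a * c i + d i).
rewrite scaler_sumr -big_split; apply: eq_bigr => i _ /=.
by rewrite scalerDl scalerA.
Qed.

Definition cat_fam (I J : finType) (e : I -> T) (d : J -> T) (x : I + J) :=
  match x with inl i => e i | inr j => d j end.

Lemma span_fam_cat (I J : finType) (e : I -> T) (d : J -> T) u v :
  span_fam e u -> span_fam d v -> span_fam (cat_fam e d) (u + v).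
Proof.
move=> [c ->] [b ->]; exists (fun x => match x with inl i => c i | inr j => b j end).
by rewrite big_sumType.
Qed.
Lemma span_fam_catl (I J : finType) (e : I -> T) (d : J -> T) u :
  span_fam e u -> span_fam (cat_fam e d) u.
Proof.
by move=> eu; rewrite -[u]addr0; apply: span_fam_cat => //; case: (span_fam_subspace d).
Qed.
Lemma span_fam_catr (I J : finType) (e : I -> T) (d : J -> T) u :
  span_fam d u -> span_fam (cat_fam e d) u.
Proof.
by move=> eu; rewrite -[u]add0r; apply: span_fam_cat => //; case: (span_fam_subspace e).
Qed.

(** Linear dependence in the quotient by [A]. Quotient spaces are never formed; sections are handled
    through congruences modulo a subspace. *)
Definition dependent_mod A n (e : 'I_n -> T) :=
  exists c : 'I_n -> K, (exists i, c i <> 0) /\ A (\sum_i c i *: e i).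

(** For subspaces this encodes dim (A + B)/A < n without choosing a basis. It fails for [n = 0], the
    empty family being independent. *)
Definition dim_lt_mod A B n :=
  forall e : 'I_n -> T, (forall i, B (e i)) -> dependent_mod A e.

(** A coefficient matrix with one more row than columns has a nonzero row vector in its left kernel,
    whose entries form a relation modulo [A]. *)
Lemma span_dim_lt A (I : finType) (e : I -> T) : subspace A ->
  dim_lt_mod A (fun u => exists v, span_fam e v /\ A (u - v)) #|I|.+1.
Proof.
move=> sA x Bx.
have /fin_all_exists [phi phiP] i :
    exists c : I -> K, A (x i - \sum_j c j *: e j).
  by have [_ [[c ->] ?]] := Bx i; exists c.
pose M : 'M[K]_(#|I|.+1, #|I|) := \matrix_(i, j) phi i (enum_val j).
have /rowV0Pn[w /sub_kermxP kM nz_w] : kermx M != 0.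
  by rewrite -mxrank_eq0 mxrank_ker subn_eq0 -ltnNge ltnS rank_leq_col.
pose c i := w 0 i.
exists c; split.
  by have [i /eqP ci] := rV0Pn _ nz_w; exists i.
have -> : \sum_i c i *: x i = \sum_i c i *: (x i - \sum_j phi i j *: e j).
  apply/eqP; rewrite -subr_eq0 -sumrB; apply/eqP.
  under eq_bigr do rewrite -scalerBr opprB addrC subrK scaler_sumr.
  rewrite exchange_big big1 // => j _ /=.
  under eq_bigr do rewrite scalerA.
  rewrite -scaler_suml; suff -> : \sum_i c i * phi i j = 0 by rewrite scale0r.
  have /matrixP/(_ 0 (enum_rank j)) := kM; rewrite !mxE => kMj; rewrite -[RHS]kMj.
  by apply: eq_bigr => i _; rewrite mxE enum_rankK.
by apply: subspace_sum => // i; apply: subspaceZ.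
Qed.

(** Induction on the bound: if it cannot be lowered to [n], some independent family of [n] vectors
    exists, and it spans [B] modulo [A] because [n + 1] vectors are always dependent. *)
Lemma basis_mod A B n : subspace A -> dim_lt_mod A B n ->
  exists r (b : 'I_r -> T), [/\ forall i, B (b i), ~ dependent_mod A b
    & forall u, B u -> exists c : 'I_r -> K, A (u - \sum_i c i *: b i)].
Proof.
move=> sA; elim: n => [|n IHn] dimB.
  have B0 (i : 'I_0) : B 0 by case: i.
  by have [c [[[]]]] := dimB (fun=> 0) B0.
have [/IHn //|ndim] := pselect (dim_lt_mod A B n).
have [e [Be nde]] : exists e : 'I_n -> T, (forall i, B (e i)) /\ ~ dependent_mod A e.
  apply: contrapT => /forallNP h; apply: ndim => e Be; apply: contrapT => nde.
  by apply: (h e).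
exists n, e; split=> // u Bu.
have [|c [[i nz_ci]]] := dimB (fun i => if unlift ord0 i is Some j then e j else u).
  by move=> i; case: unliftP.
rewrite big_ord_recl unlift_none.
under eq_bigr do rewrite liftK.
(* Index [ord0] carries [u]. A zero coefficient there would leave a relation among the [e j] alone;
   otherwise the relation is solved for [u]. *)
have [c0 | nz_c0] := eqVneq (c ord0) 0.
  rewrite c0 scale0r add0r => Ac; case: nde; exists (fun j => c (lift ord0 j)).
  split=> //; case: (unliftP ord0 i) nz_ci => [j ->|->]; by [exists j|rewrite c0].
move=> Ac; exists (fun j => - ((c ord0)^-1 * c (lift ord0 j))).
have := subspaceZ (c ord0)^-1 sA Ac.
rewrite scalerDr scalerA mulVf // scale1r scaler_sumr.
congr (A (_ + _)); rewrite -sumrN; apply: eq_bigr => j _.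
by rewrite scaleNr opprK scalerA.
Qed.

End Subspaces.

(** * Solvable ideals of irreducible matrix Lie algebras *)

Section Matrices.
Variables (K : numClosedFieldType) (m : nat).
Implicit Types (L I : 'M[K]_m -> Prop) (x y g l : 'M[K]_m).

Definition mxbracket x y := x *m y - y *m x.
Definition mxderived I (x : 'M[K]_m) := forall T : 'M[K]_m -> Prop, subspace T ->
  (forall a b, I a -> I b -> T (mxbracket a b)) -> T x.
Definition mxirreducible L := forall U : 'rV[K]_m -> Prop, subspace U ->
  (forall l u, L l -> U u -> U (u *m l)) -> forall v, v != 0 -> U v -> forall u, U u.

Lemma mxbracketE x y : x *m y = y *m x + mxbracket x y.
Proof. by rewrite addrC subrK. Qed.

Lemma mxderived_subspace I : subspace (mxderived I).
Proof.
split=> [T [T0 _] _ //|a x y Ix Iy T sT TI]; case: (sT) => _; apply; first exact: Ix.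
exact: Iy.
Qed.

(** Reduces linear statements about [I] to finitely many of its elements, as common eigenvectors and
    local solvability require. *)
Lemma mxspan_basis I : exists s : seq 'M[K]_m, (forall x, x \in s -> I x) /\
  forall T, subspace T -> (forall x, x \in s -> T x) -> incl I T.
Proof.
have s0 : subspace (fun x : 'M[K]_m => x = 0).
  by split=> // a x y -> ->; rewrite scaler0 addr0.
have [] := @basis_mod _ _ _ I #|{: 'I_m * 'I_m}|.+1 s0.
  move=> b Ib; apply: (span_dim_lt (e := fun ij : 'I_m * 'I_m => delta_mx ij.1 ij.2)) => // i.
  exists (b i); split; last by rewrite subrr.
  by exists (fun ij => b i ij.1 ij.2); rewrite {1}[b i]matrix_sum_delta pair_bigA.
move=> r [b [Ib _ bP]]; exists [seq b i | i : 'I_r]; split.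
  by move=> _ /mapP[i _ ->].
move=> T sT Tb x /bP[c /eqP]; rewrite subr_eq0 => /eqP ->.
by apply: subspace_sum => // i; apply: subspaceZ => //; apply/Tb/map_f; rewrite mem_enum.
Qed.

Section Commuting.
Variables (L I : 'M[K]_m -> Prop).
Hypotheses (irrL : mxirreducible L) (LI : forall l g, L l -> I g -> I (mxbracket l g)).
Hypothesis commI : forall x y, I x -> I y -> x *m y = y *m x.

(* [l] maps the kernel of [(g - c)^N] to that of [(g - c)^(N+1)], because
   [l, g] commutes with [g]; so the generalised eigenspace is [L]-stable. *)
Lemma generalised_eigenspace_full g c (v : 'rV_m) : I g -> v != 0 -> v *m g = c *: v ->
  forall u : 'rV_m, exists N, u *m (g - c%:M) ^+ N = 0.
Proof.
move=> Ig nz_v vg; set h := g - c%:M.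
have hS N : h ^+ N.+1 = h *m h ^+ N by rewrite exprS.
have hD N d u : u *m h ^+ N = 0 -> u *m h ^+ (N + d) = 0.
  by move=> uN; rewrite exprD mulmxA uN mul0mx.
apply: irrL nz_v _.
- split=> [|a x y [N xN] [N' yN]]; first by exists 0%N; rewrite mul0mx.
  exists (N + N')%N; rewrite mulmxDl -scalemxAl hD // scaler0 add0r.
  by rewrite addnC hD.
- move=> l u Ll [N uN]; exists N.+1; elim: N u uN => [|N IHN] u H.
    by move: H; rewrite expr0 mulmx1 => ->; rewrite !mul0mx.
  have lh : l *m h = h *m l + mxbracket l g.
    rewrite /mxbracket /h mulmxBr mulmxBl scalar_mxC.
    by apply/matrixP => i j; rewrite !mxE; ring.
  have hx : mxbracket l g *m h = h *m mxbracket l g.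
    by rewrite [LHS]mulmxBr [RHS]mulmxBl scalar_mxC (commI (LI Ll Ig) Ig).
  have hxN n : mxbracket l g *m h ^+ n = h ^+ n *m mxbracket l g.
    elim: n => [|n IHn]; first by rewrite expr0 mulmx1 mul1mx.
    by rewrite hS mulmxA hx -mulmxA IHn mulmxA.
  rewrite hS mulmxA -[u *m l *m h]mulmxA lh mulmxDr mulmxDl mulmxA IHN.
    by rewrite add0r -mulmxA hxN mulmxA H mul0mx.
  by rewrite -mulmxA -hS.
by exists 1%N; rewrite expr1 mulmxBr vg mul_mx_scalar subrr.
Qed.

Lemma nilpotent_uniform h : (forall u : 'rV[K]_m, exists N, u *m h ^+ N = 0) ->
  exists N, h ^+ N = 0.
Proof.
move=> nil_h; have /fin_all_exists[N hN] i := nil_h (row i 1%:M).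
exists (\sum_i N i)%N; apply/row_matrixP => i; rewrite row0 -[_ ^+ _]mul1mx row_mul.
by rewrite (bigD1 i) //= exprD mulmxA hN mul0mx.
Qed.

(** If c were nonzero, x = [l, g] would be invertible, since x - c is nilpotent. For the nilpotent h
    = g - a, the identity [l, h^(n+1)] = (n+1) h^n x then pulls h^N = 0 down to h^0 = 0, in
    characteristic zero. *)
Lemma bracket_eigenvalue0 l g c (v : 'rV_m) : L l -> I g -> v != 0 ->
  v *m mxbracket l g = c *: v -> c = 0.
Proof.
move=> Ll Ig nz_v vx; have [x xE] : exists x : 'M[K]_m, x = mxbracket l g by exists (mxbracket l g).
rewrite -xE in vx; apply/eqP/negP => /negP nz_c.
have Ix : I x by rewrite xE; apply: LI.
have m_gt0 : (0 < m)%N.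
  rewrite lt0n; apply: contraNneq nz_v => m0; apply/eqP/rowP => -[i lt_i].
  by exfalso; move: lt_i; rewrite m0.
(* If u x = 0, then u (x - c)^n = (-c)^n u, while some power of x - c vanishes. *)
have x_inj (u : 'M_m) : u *m x = 0 -> u = 0.
  move=> ux; have [N xN] := nilpotent_uniform (generalised_eigenspace_full Ix nz_v vx).
  have uN n : u *m (x - c%:M) ^+ n = (- c) ^+ n *: u.
    elim: n => [|n IHn]; first by rewrite !expr0 mulmx1 scale1r.
    rewrite exprSr mulmxA IHn -scalemxAl mulmxBr ux mul_mx_scalar sub0r.
    by rewrite exprSr -scalerA scaleNr.
  have /eqP := uN N; rewrite xN mulmx0 eq_sym scaler_eq0 expf_eq0 oppr_eq0.
  by rewrite (negPf nz_c) andbF => /eqP.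
have [a /eigenvalueP[w wg nz_w]] := eigenvalue_closed g m_gt0.
have [N hN] := nilpotent_uniform (generalised_eigenspace_full Ig nz_w wg).
have [h hE] : exists h : 'M[K]_m, h = g - a%:M by exists (g - a%:M).
rewrite -hE in hN.
have xh : x *m h = h *m x.
  by rewrite hE mulmxBr mulmxBl scalar_mxC (commI Ix Ig).
have hSr n : h ^+ n.+1 = h ^+ n *m h by apply: exprSr.
have lhN n : l *m h ^+ n.+1 - h ^+ n.+1 *m l = n.+1%:R *: (h ^+ n *m x).
  elim: n => [|n IHn].
    rewrite expr1 expr0 mul1mx scale1r xE /mxbracket hE mulmxBr mulmxBl scalar_mxC.
    by apply/matrixP => i j; rewrite !mxE; ring.
  have -> : l *m h ^+ n.+2 - h ^+ n.+2 *m l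
      = (l *m h ^+ n.+1 - h ^+ n.+1 *m l) *m h + h ^+ n.+1 *m (l *m h ^+ 1 - h ^+ 1 *m l).
    rewrite [h ^+ n.+2]hSr expr1 mulmxBl mulmxBr !mulmxA.
    by apply/matrixP => i j; rewrite !mxE; ring.
  rewrite IHn; have -> : l *m h ^+ 1 - h ^+ 1 *m l = x.
    rewrite expr1 xE /mxbracket hE mulmxBr mulmxBl scalar_mxC.
    by apply/matrixP => i j; rewrite !mxE; ring.
  rewrite -scalemxAl -mulmxA xh mulmxA -hSr.
  by rewrite -[in RHS]natr1 scalerDl scale1r.
(* Descent on the exponent: h^(N+1) = 0 gives h^N x = 0, hence h^N = 0. *)
elim: N hN => [|N IHN] hN.
  suff : v = 0 by apply/eqP.
  by rewrite -[v]mulmx1 -[1%:M](expr0 h) hN mulmx0.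
apply/IHN/x_inj/eqP; have := lhN N.
rewrite hN mulmx0 mul0mx subrr => /esym/eqP.
by rewrite scaler_eq0 pnatr_eq0.
Qed.

(** A common eigenvector [v] of the commuting family [I] exists. Its weight space is [L]-stable
    because the weight vanishes on brackets [l, x], so irreducibility makes it the whole space. *)
Lemma commuting_ideal_scalar g : I g -> exists c, g = c%:M.
Proof.
move=> Ig; have [m0|m_gt0] := posnP m.
  by exists 0; apply/matrixP => -[i lt_i]; exfalso; move: lt_i; rewrite m0.
have [s [sI Is]] := mxspan_basis I.
have [|v nz_v /allP vs] := @common_eigenvector _ _ s m_gt0.
  by move=> x y /sI Ix /sI Iy; apply: commI.
have vI x : I x -> exists c, v *m x = c *: v.
  move: x; apply: Is => [|x /vs/sub_rVP //]; split; first by exists 0; rewrite mulmx0 scale0r.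
  move=> a x y [c vx] [d vy]; exists (a * c + d).
  by rewrite mulmxDr -scalemxAr vx vy scalerA scalerDl.
have [c vg] := vI _ Ig; exists c.
(* The weight space of [v], described without a weight functional: each [x] in [I] acts on [u] by
   its eigenvalue at [v]. *)
have full : forall u : 'rV_m, forall x d, I x -> v *m x = d *: v -> u *m x = d *: u.
  apply: (@irrL _ _ _ v nz_v) => //.
    split=> [x d _ _|a u w Pu Pw x d Ix vx]; first by rewrite mul0mx scaler0.
    by rewrite mulmxDl -scalemxAl (Pu x d) // (Pw x d) // scalerDr !scalerA mulrC.
  move=> l u Ll Pu x d Ix vx.
  rewrite -mulmxA mxbracketE mulmxDr mulmxA (Pu x d) // -scalemxAl.
  have Ilx := LI Ll Ix; have [b vlx] := vI _ Ilx.
  have b0 := bracket_eigenvalue0 Ll Ix nz_v vlx; rewrite b0 in vlx.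
  by rewrite (Pu _ 0 Ilx vlx) scale0r addr0.
apply/row_matrixP => i; rewrite -[g]mul1mx -[c%:M]mul1mx !row_mul.
by rewrite (full _ _ c) // mul_mx_scalar.
Qed.

End Commuting.

(** Induction on the derived length: the derived ideal acts by scalars, and a scalar commutator has
    trace zero, hence vanishes. So [I] is commutative and the previous case applies. *)
Lemma solvable_ideal_scalar L I : mxirreducible L -> subspace I ->
  (forall l g, L l -> I g -> I (mxbracket l g)) -> (exists n, incl (iter n mxderived I) (eq^~ 0)) ->
  forall g, I g -> exists c, g = c%:M.
Proof.
move=> irrL + + [n]; elim: n I => [|n IHn] I sI LI solI g Ig.
  by exists 0; rewrite (solI _ Ig) raddf0.
have dLI l x : L l -> mxderived I x -> mxderived I (mxbracket l x).
  move=> Ll Ix; apply: (Ix (fun x => mxderived I (mxbracket l x))) => [|a b Ia Ib].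
    have [d0 dD] := mxderived_subspace I; split.
      by rewrite /mxbracket mulmx0 mul0mx subrr.
    move=> a y z dy dz; have := dD a _ _ dy dz; congr mxderived.
    rewrite /mxbracket mulmxDr mulmxDl -scalemxAl -scalemxAr.
    by apply/matrixP => i j; rewrite !mxE; ring.
  have -> : mxbracket l (mxbracket a b)
          = mxbracket (mxbracket l a) b + mxbracket a (mxbracket l b).
    rewrite /mxbracket !mulmxBl !mulmxBr !mulmxA.
    by apply/matrixP => i j; rewrite !mxE; ring.
  apply: (subspaceD (mxderived_subspace I)) => T sT; apply => //; exact: LI.
apply: (commuting_ideal_scalar irrL LI) Ig => x y Ix Iy; apply/eqP.
rewrite -subr_eq0; apply/eqP; rewrite -/(mxbracket x y).
have dxy : mxderived I (mxbracket x y) by move=> T sT; apply.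
have [|c] := IHn _ (mxderived_subspace I) dLI _ _ dxy.
  by move: solI; rewrite iterSr.
move=> cE; have : \tr (mxbracket x y) = 0 by rewrite raddfB /= mxtrace_mulC subrr.
rewrite cE mxtrace_scalar => /eqP; rewrite -mulr_natr mulf_eq0 pnatr_eq0.
case/orP=> /eqP; first by move->; rewrite raddf0.
by move=> m0; apply/matrixP => -[i lt_i]; exfalso; move: lt_i; rewrite m0.
Qed.

End Matrices.

(** * Locally solvable ideals of finitary Lie algebras *)

Section Operators.
Variables (K : fieldType) (V : lmodType K).
Implicit Types (f g h : End V) (S T : End V -> Prop).

Definition linE f := forall a x y, f (a *: x + y) = a *: f x + f y.

Lemma linE0 f : linE f -> f 0 = 0.
Proof. by move=> lf; have := lf (-1) 0 0; rewrite scaler0 addr0 scaleN1r addNr. Qed.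
Lemma linED f x y : linE f -> f (x + y) = f x + f y.
Proof. by move=> lf; have := lf 1 x y; rewrite !scale1r. Qed.
Lemma linEZ f a x : linE f -> f (a *: x) = a *: f x.
Proof. by move=> lf; have := lf a x 0; rewrite (linE0 lf) !addr0. Qed.
Lemma linEB f x y : linE f -> f (x - y) = f x - f y.
Proof. by move=> lf; rewrite linED // -scaleN1r linEZ // scaleN1r. Qed.
Lemma linE_sum f (I : finType) (F : I -> V) : linE f -> f (\sum_i F i) = \sum_i f (F i).
Proof. by move=> lf; apply: (big_morph f) => [x y|]; [apply: linED|apply: linE0]. Qed.

Lemma derived_subspaceE S : subspaceE (derived S).
Proof.
split=> [T [T0 _] _ //|a x y Sx Sy T sT TS]; case: (sT) => _; apply; first exact: Sx.
exact: Sy.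
Qed.

Lemma derived_sub S T : subspaceE T -> (forall f g, S f -> S g -> T (bracket f g)) ->
  incl (derived S) T.
Proof. by move=> sT ST f; apply. Qed.

Lemma iter_derived_sub n S T : subspaceE T -> (forall f g, T f -> T g -> T (bracket f g)) ->
  incl S T -> incl (iter n (@derived K V) S) T.
Proof.
move=> sT TT ST; elim: n => //= n IHn; apply: derived_sub => // f g /IHn Tf /IHn Tg.
exact: TT.
Qed.

Lemma genAlg_lieSub n (g : nat -> End V) : lieSub (genAlg n g).
Proof.
split; first split.
- by move=> T [[T0 _] _].
- move=> a f h Gf Gh T lT gT; case: (lT) => -[_ TD] _; apply: TD; [exact: Gf|exact: Gh].
- move=> f h Gf Gh T lT gT; case: (lT) => _; apply; [exact: Gf|exact: Gh].
Qed.

Lemma genAlg_gen n (g : nat -> End V) i : (i < n)%N -> genAlg n g (g i).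
Proof. by move=> lt_in T _; apply. Qed.

Lemma locSolv_sub S T : incl S T -> locSolv T -> locSolv S.
Proof. by move=> ST lT n g gS; apply: lT => i /gS /ST. Qed.

End Operators.

(** * Action of a locally solvable ideal on a finite-dimensional irreducible section *)

Section FiniteSection.
Variables (K : numClosedFieldType) (V : lmodType K).
Variables (L J : End V -> Prop) (P1 P : V -> Prop).
Hypotheses (linL : forall f, L f -> linE f) (lieL : lieSub L).
Hypotheses (idJ : ideal L J) (lsJ : locSolv J).
Hypotheses (sP1 : subspace P1) (sP : subspace P) (irrP : irredV L P1 P).

Section Basis.
Variables (r : nat) (b : 'I_r -> V).
Hypotheses (Pb : forall i, P (b i)) (freeb : ~ dependent_mod P1 b).
Hypothesis genb : forall u, P u -> exists c : 'I_r -> K, P1 (u - \sum_i c i *: b i).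

(** Row [i] holds the coordinates of [h (b i)] modulo [P1]. Coordinate rows are thus acted on from
    the right, which reverses products and brackets. *)
Definition matrix_mod (h : End V) (A : 'M[K]_r) :=
  forall i, P1 (h (b i) - \sum_j A i j *: b j).
Definition matrices_mod (S : End V -> Prop) (A : 'M[K]_r) :=
  exists h, [/\ S h, L h & matrix_mod h A].

Lemma matrix_mod_exists h : L h -> exists A, matrix_mod h A.
Proof.
move=> Lh; have [_ stab _] := irrP; have [_ stabP] := stab h Lh.
have /fin_all_exists[A AP] i := genb (stabP _ (Pb i)).
by exists (\matrix_(i, j) A i j) => i; under eq_bigr do rewrite mxE; apply: AP.
Qed.

Lemma free_mod (c : 'I_r -> K) : P1 (\sum_i c i *: b i) -> forall i, c i = 0.
Proof. by move=> Pc i; apply: contrapT => ci; apply: freeb; exists c; split=> //; exists i. Qed.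

Lemma matrix_mod_scale_add a f g A B :
  matrix_mod f A -> matrix_mod g B -> matrix_mod (addE (scaleE a f) g) (a *: A + B).
Proof.
move=> fA gB i; have := (sP1.2) a _ _ (fA i) (gB i); congr P1.
under [in RHS]eq_bigr do rewrite !mxE scalerDl -scalerA.
by rewrite big_split -scaler_sumr /= /addE /scaleE scalerBr addrACA -opprD.
Qed.

Lemma matrix_mod_apply h A (w : 'rV_r) : L h -> matrix_mod h A ->
  P1 (h (\sum_i w 0 i *: b i) - \sum_i (w *m A) 0 i *: b i).
Proof.
move=> Lh hA; have lh := linL Lh.
suff -> : h (\sum_i w 0 i *: b i) - \sum_i (w *m A) 0 i *: b i
     = \sum_i w 0 i *: (h (b i) - \sum_j A i j *: b j).
  by apply: subspace_sum => // i; apply: subspaceZ.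
rewrite linE_sum //; under [in RHS]eq_bigr do rewrite scalerBr.
rewrite sumrB; congr (_ - _); first by apply: eq_bigr => i _; rewrite linEZ.
under eq_bigr do rewrite mxE scaler_suml.
rewrite exchange_big; apply: eq_bigr => i _; rewrite scaler_sumr.
by apply: eq_bigr => j _; rewrite scalerA.
Qed.

Lemma matrix_mod_comp f g A B : L f -> L g -> matrix_mod f A -> matrix_mod g B ->
  matrix_mod (f \o g) (B *m A).
Proof.
move=> Lf Lg fA gB i; have lf := linL Lf.
have [_ stab _] := irrP; have [stab1 _] := stab f Lf.
have := subspaceD sP1 (stab1 _ (gB i)) (matrix_mod_apply (row i B) Lf fA).
have rowE (C : 'M_r) : \sum_j row i C 0 j *: b j = \sum_j C i j *: b j.
  by apply: eq_bigr => j _; rewrite mxE.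
by rewrite (linEB _ _ lf) -row_mul !rowE addrA subrK.
Qed.

Lemma matrix_mod_bracket f g A B : L f -> L g -> matrix_mod f A -> matrix_mod g B ->
  matrix_mod (bracket f g) (mxbracket B A).
Proof.
move=> Lf Lg fA gB.
have := matrix_mod_scale_add (-1) (matrix_mod_comp Lg Lf gB fA) (matrix_mod_comp Lf Lg fA gB).
have -> : addE (scaleE (-1) (g \o f)) (f \o g) = bracket f g.
  by apply/funext => u; rewrite /addE /scaleE scaleN1r addrC.
by rewrite scaleN1r addrC.
Qed.

Lemma matrices_mod_subspace S : subspaceE S -> subspace (matrices_mod S).
Proof.
move=> [S0 SD]; have [[L0 LD] _] := lieL; split.
  exists (@zeroE K V); split=> // i; under eq_bigr do rewrite mxE scale0r.
  by rewrite big1 // subrr; case: sP1.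
move=> a A B [f [Sf Lf fA]] [g [Sg Lg gB]]; exists (addE (scaleE a f) g).
by split; [apply: SD|apply: LD|apply: matrix_mod_scale_add].
Qed.

(** An invariant space [U] of coordinate rows pulls back to a submodule [Q] between [P1] and [P]. *)
Lemma matrices_mod_irreducible : mxirreducible (matrices_mod L).
Proof.
move=> U sU stabU v nz_v Uv u.
pose Q x := P x /\ exists2 w : 'rV_r, U w & P1 (x - \sum_i w 0 i *: b i).
have [[P1P _] stab simple] := irrP.
have Pw (w : 'rV_r) : P (\sum_i w 0 i *: b i).
  by apply: subspace_sum => // i; apply: subspaceZ.
have sQ : subspace Q.
  split; first split; first by case: sP.
    exists 0; first by case: sU.
    by under eq_bigr do rewrite mxE scale0r; rewrite big1 // subrr; case: sP1.
  move=> a x y [Px [w Uw xw]] [Py [z Uz yz]]; split; first by case: sP => _; apply.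
  exists (a *: w + z); first by case: sU => _; apply.
  have := (sP1.2) a _ _ xw yz; congr P1.
  under [in RHS]eq_bigr do rewrite !mxE scalerDl -scalerA.
  by rewrite big_split -scaler_sumr /= scalerBr addrACA -opprD.
have [] := simple Q sQ.
- move=> x P1x; split; first exact: P1P.
  exists 0; first by case: sU.
  by under eq_bigr do rewrite mxE scale0r; rewrite big1 // subr0.
- by move=> x [].
- move=> f Lf x [Px [w Uw xw]]; have [stab1 stabP] := stab f Lf; split; first exact: stabP.
  have [A fA] := matrix_mod_exists Lf; exists (w *m A).
    by apply: stabU => //; exists f.
  have := subspaceD sP1 (stab1 _ xw) (matrix_mod_apply w Lf fA).
  by rewrite (linEB _ _ (linL Lf)) addrA subrK.
- move=> QP1; case/eqP: nz_v; apply/rowP => i; rewrite mxE.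
  apply: (@free_mod (v 0)); apply/QP1; split; first exact: Pw.
  by exists v => //; rewrite subrr; case: sP1.
- move=> QP; have /QP[_ [w Uw]] := Pw u.
  rewrite -sumrB; under eq_bigr do rewrite -scalerBl.
  move/free_mod=> uw; have -> // : u = w.
  by apply/rowP => i; apply/eqP; rewrite -subr_eq0 uw.
Qed.

(** Finitely many operators of [J] already represent a spanning set of its matrices. The algebra
    they generate is solvable, and its derived series covers that of the matrices. *)
Lemma matrices_mod_solvable : exists n, incl (iter n (@mxderived K r) (matrices_mod J)) (eq^~ 0).
Proof.
have [s [sJ Js]] := mxspan_basis (matrices_mod J).
have /fin_all_exists[h hP] (i : 'I_(size s)) : exists h, [/\ J h, L h & matrix_mod h s`_i].
  by apply: sJ; apply: mem_nth.
(* Local solvability takes families indexed by [nat], so the finite family is padded with zero. *)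
pose g i := oapp h (@zeroE K V) (insub i).
have gE (i : 'I_(size s)) : g i = h i by rewrite /g valK.
have Jg i : (i < size s)%N -> J (g i).
  by move=> lt_i; rewrite (gE (Ordinal lt_i)); case: (hP (Ordinal lt_i)).
have [n solG] := lsJ Jg; exists n.
have sder m : subspaceE (iter m (@derived K V) (genAlg (size s) g)).
  by case: m => [|m] /=; [case: (genAlg_lieSub (size s) g)|apply: derived_subspaceE].
have sub m : incl (iter m (@mxderived K r) (matrices_mod J))
                  (matrices_mod (iter m (@derived K V) (genAlg (size s) g))).
  elim: m => [|m IHm] /=.
    apply: Js; first exact: matrices_mod_subspace (sder 0%N).
    move=> _ /(nthP 0)[i lt_i <-]; have [_ Lh hA] := hP (Ordinal lt_i).
    exists (g i); split; first exact: genAlg_gen.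
      by rewrite (gE (Ordinal lt_i)).
    by rewrite (gE (Ordinal lt_i)).
  move=> A; apply; first exact: matrices_mod_subspace (sder m.+1).
  move=> B C /IHm[f [Sf Lf fB]] /IHm[k [Sk Lk kC]]; exists (bracket k f); split.
  - by move=> T _; apply.
  - by case: lieL => _; apply.
  - exact: matrix_mod_bracket.
move=> A /sub[f [/solG-> _ fA]]; apply/matrixP => i j; rewrite mxE.
have := fA i; rewrite sub0r => /(subspaceN sP1); rewrite opprK.
by move/free_mod.
Qed.

Lemma finite_section_scalar_basis f : J f -> exists c, forall u, P u -> P1 (f u - c *: u).
Proof.
move=> Jf; have [JL sJ LJ] := idJ; have Lf := JL _ Jf; have lf := linL Lf.
have [_ stab _] := irrP; have [stab1 _] := stab f Lf.
have [A fA] := matrix_mod_exists Lf.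
have LJM B C : matrices_mod L B -> matrices_mod J C -> matrices_mod J (mxbracket B C).
  move=> [g [_ Lg gB]] [h [Jh Lh hC]].
  exists (bracket h g); split; last exact: matrix_mod_bracket.
    (* The ideal property provides [g, h]; the reversed order of matrices asks for [h, g], its
       negative. *)
    have := sJ.2 (-1) _ _ (LJ _ _ Lg Jh) sJ.1; congr J; apply/funext => u.
    by rewrite /addE /scaleE /zeroE /bracket addr0 scaleN1r opprB.
  by case: lieL => _; apply.
have JA : matrices_mod J A by exists f.
have [c Ac] := solvable_ideal_scalar matrices_mod_irreducible
  (matrices_mod_subspace sJ) LJM matrices_mod_solvable JA.
exists c => u Pu; have [d ud] := genb Pu.
have := matrix_mod_apply (\row_i d i) Lf fA.
rewrite Ac mul_mx_scalar; under eq_bigr do rewrite mxE.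
under [X in _ - X]eq_bigr do rewrite !mxE -scalerA.
rewrite -scaler_sumr => fd.
have := subspaceB sP1 (subspaceD sP1 (stab1 _ ud) fd) (subspaceZ c sP1 ud).
by rewrite (linEB _ _ lf) addrA subrK scalerBr opprB addrA subrK.
Qed.

End Basis.

(** The operator acts on P/P1 by a scalar c, and f^N = 0 makes c^N kill this nonzero space. *)
Lemma finite_section_nilpotent n f : dim_lt_mod P1 P n -> J f -> nilpEnd f ->
  forall u, P u -> P1 (f u).
Proof.
move=> dimP Jf [N fN].
have [r [b [Pb freeb genb]]] := basis_mod sP1 dimP.
have [c fc] := finite_section_scalar_basis Pb freeb genb Jf.
have [JL _ _] := idJ; have lf := linL (JL _ Jf).
have [[_ nPP1] stab _] := irrP; have [stab1 stabP] := stab f (JL _ Jf).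
have fcN m u : P u -> P1 (iter m f u - c ^+ m *: u) /\ P (iter m f u).
  move=> Pu; elim: m => [|m [IHm Pm]] /=; first by rewrite scale1r subrr; case: sP1.
  split; last exact: stabP.
  have := subspaceD sP1 (fc _ Pm) (subspaceZ c sP1 IHm).
  by rewrite scalerBr addrA subrK scalerA -exprS.
have [c0 u /fc|nz_c] := eqVneq c 0; first by rewrite c0 scale0r subr0.
case: nPP1 => u /(fcN N)[+ _]; rewrite fN sub0r => /(subspaceN sP1).
rewrite opprK => /(subspaceZ (c ^+ N)^-1 sP1).
by rewrite scalerA mulVf ?scale1r // expf_neq0.
Qed.

End FiniteSection.

Lemma Zorn_union (T : Type) (good : (T -> Prop) -> Prop) (A0 : T -> Prop) :
  good A0 -> (exists x, A0 x) ->
  (forall F : (T -> Prop) -> Prop, (exists X, F X) -> (forall X, F X -> good X) ->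
    (forall X Y, F X -> F Y -> incl X Y \/ incl Y X) -> good (fun x => exists X, F X /\ X x)) ->
  exists A, good A /\ forall B, good B -> incl A B -> incl B A.
Proof.
move=> gA0 [x0 A0x0] goodU.
(* [Zorn_bigcup] also asks for the union of the empty chain, hence the disjunct [set0]. *)
have [F FP totF|A [PA maxA]] := @Zorn_bigcup T (fun X => X = set0 \/ good X).
  have [[X [FX gX]]|nF] := pselect (exists X, F X /\ good X); last first.
    left; apply/predeqP => x; split=> // -[X FX Xx].
    by case: (FP X FX) => [X0|gX]; [rewrite X0 in Xx|case: nF; exists X].
  right; suff -> : (\bigcup_(Y in F) Y)%classic = (fun x => exists Y, (F Y /\ good Y) /\ Y x).
    apply: goodU => [|Y []//|Y Z [FY _] [FZ _]]; first by exists X.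
    exact: totF.
  apply/predeqP => x; split=> [[Y FY Yx]|[Y [[FY _] Yx]]]; last by exists Y.
  exists Y; split=> //; split=> //; case: (FP Y FY) => // Y0.
  by rewrite Y0 in Yx.
have maxA' B : good B -> incl A B -> incl B A.
  move=> gB AB; apply: contrapT => nBA; apply: (maxA B); last by right.
  by split.
exists A; split=> //; case: PA => // A_0; suff -> : A = A0 by [].
(* An empty [A] cannot be maximal, because [A0] is good and inhabited. *)
by have := maxA' _ gA0; rewrite A_0 => /(_ (fun _ => False_ind _))/(_ _ A0x0).
Qed.

(** * Nilpotent elements of the radical on irreducible sections of arbitrary dimension *)

Section Radical.
Variables (K : numClosedFieldType) (V : lmodType K).

Definition finrank (h : End V) := exists (I : finType) (e : I -> V), forall u, span_fam e (h u).

Variables (L R : End V -> Prop) (F1 F2 : V -> Prop).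
Hypotheses (linL : forall h, L h -> linE h) (finL : forall h, L h -> finrank h).
Hypotheses (lieL : lieSub L) (idR : ideal L R) (lsR : locSolv R).
Hypotheses (sF1 : subspace F1) (sF2 : subspace F2) (irrF : irredV L F1 F2).

(** Stands in for a finite set of elements: it is a subalgebra, and any finitely many elements of
    [L], having finite rank, lie in one of this form. *)
Definition range_in (I : finType) (e : I -> V) (h : End V) := L h /\ forall u, span_fam e (h u).

Lemma range_in_lieSub (I : finType) (e : I -> V) : lieSub (range_in e).
Proof.
have se := span_fam_subspace e; have [[L0 LD] LB] := lieL.
split; first split.
- by split=> // u; case: se.
- by move=> a f g [Lf ef] [Lg eg]; split; [apply: LD|move=> u; apply: (se.2)].
- by move=> f g [Lf ef] [Lg eg]; split; [apply: LB|move=> u; apply: subspaceB].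
Qed.

Definition generated (I : finType) (e : I -> V) (y u : V) := forall Q : V -> Prop,
  subspace Q -> incl F1 Q -> Q y -> (forall h, range_in e h -> stabV h Q) -> Q u.

Lemma generated_mono (I J : finType) (e : I -> V) (d : J -> V) y u :
  incl (range_in e) (range_in d) -> generated e y u -> generated d y u.
Proof. by move=> ed eu Q sQ F1Q Qy dQ; apply: eu => // h /ed; apply: dQ. Qed.

Lemma generated_subspace (I : finType) (e : I -> V) y : subspace (generated e y).
Proof.
split=> [Q [] //|a u v gu gv Q sQ F1Q Qy stQ].
by apply: (sQ.2); [apply: gu|apply: gv].
Qed.

(** The vectors reachable from [y] through some finite [e] form an [L]-submodule, since the families
    for two vectors can be concatenated. It contains [y], so it is all of [F2]. *)
Lemma irreducible_generated y x : F2 y -> ~ F1 y -> F2 x ->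
  exists (I : finType) (e : I -> V), generated e y x.
Proof.
move=> F2y nF1y F2x; have [[F12 _] stab simple] := irrF.
pose M u := F2 u /\ exists (I : finType) (e : I -> V), generated e y u.
have [] := simple M.
- split.
    split; first by apply: F12; case: sF1.
    exists 'I_0, (fun=> 0); exact: (generated_subspace _ _).1.
  move=> a u v [F2u [I [e eu]]] [F2v [J [d dv]]].
  split; first exact: (sF2.2).
  exists (I + J)%type, (cat_fam e d); apply: (generated_subspace _ _).2.
    by apply: generated_mono eu => g [Lg eg]; split=> // w; apply: span_fam_catl.
  by apply: generated_mono dv => g [Lg dg]; split=> // w; apply: span_fam_catr.
- move=> u F1u; split; first exact: F12.
  by exists 'I_0, (fun=> 0) => Q sQ F1Q Qy _; apply: F1Q.
- by move=> u [].
- move=> h Lh u [F2u [I [e eu]]]; have [_ stab2] := stab h Lh; split; first exact: stab2.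
  have [J [d hd]] := finL Lh; exists (I + J)%type, (cat_fam e d).
  move=> Q sQ F1Q Qy stQ; apply: (stQ h).
    by split=> // w; apply: span_fam_catr.
  apply: (@generated_mono _ _ e) eu _ sQ F1Q Qy stQ => g [Lg eg].
  by split=> // w; apply: span_fam_catl.
- move=> MF1; case: nF1y; apply/MF1; split=> //.
  by exists 'I_0, (fun=> 0) => Q.
- by move=> /(_ x)[_ /(_ F2x)[]].
Qed.

(** Reduction to finite dimension: if [f x] were outside [F1], it would generate [x] under some
    [range_in e] containing [f], and [f] would map [x] nontrivially in an irreducible
    finite-dimensional section. *)
Lemma locSolv_nilpotent_trivial f : R f -> nilpEnd f -> forall x, F2 x -> F1 (f x).
Proof.
move=> Rf nf x F2x; apply: contrapT => nF1fx.
have [RL sR LR] := idR; have Lf := RL _ Rf; have [_ stab _] := irrF.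
have [I0 [e0 e0x]] := irreducible_generated ((stab f Lf).2 _ F2x) nF1fx F2x.
have [J [d fd]] := finL Lf.
have [I [e [ex ef]]] : exists (I : finType) (e : I -> V), generated e (f x) x /\ range_in e f.
  exists (I0 + J)%type, (cat_fam e0 d); split; last first.
    by split=> // w; apply: span_fam_catr.
  by apply: generated_mono e0x => g [Lg eg]; split=> // w; apply: span_fam_catl.
set P := generated e (f x) in ex.
have sP : subspace P by apply: generated_subspace.
have Pfx : P (f x) by move=> Q.
have stP h : range_in e h -> stabV h P.
  by move=> eh u Pu Q sQ F1Q Qfx stQ; apply: (stQ) => //; apply: Pu.
(* P/F1 is finite-dimensional: the generator [f x] and all images under [range_in e] lie in the span
   of [e]. *)
have PE u : P u -> exists v, span_fam e v /\ F1 (u - v).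
  move=> Pu; have se := span_fam_subspace e.
  apply: (Pu (fun u => exists v, span_fam e v /\ F1 (u - v))).
  - split; first by exists 0; rewrite subrr; split; [case: se|case: sF1].
    move=> a v w [v' [ev Fv]] [w' [ew Fw]]; exists (a *: v' + w').
    split; first exact: (se.2).
    by have := (sF1.2) a _ _ Fv Fw; rewrite scalerBr addrACA -opprD.
  - by move=> v Fv; exists 0; rewrite subr0; split=> //; case: se.
  - exists (f x); rewrite subrr; split; last by case: sF1.
    exact: ef.2.
  - move=> h [Lh eh] v _; exists (h v); rewrite subrr; split=> //; by case: sF1.
(* A maximal submodule of [P] avoiding the generator [f x] is a maximal proper submodule, so it
   leaves an irreducible quotient. *)
pose good (Q : V -> Prop) := [/\ subspace Q, incl F1 Q, incl Q P,
  forall h, range_in e h -> stabV h Q & ~ Q (f x)].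
have [||F [X0 FX0] Fgood Fchain|P1 [[sP1 F1P1 P1P stP1 nP1] maxP1]] := @Zorn_union V good F1.
- split=> // [u Fu Q|h [Lh _]]; first by move=> _ F1Q _ _; apply: F1Q.
  exact: (stab h Lh).1.
- by exists 0; case: sF1.
- split.
  + split; first by exists X0; split=> //; case: (Fgood _ FX0) => -[].
    move=> a u v [X [FX Xu]] [Y [FY Yv]].
    have [XY|YX] := Fchain _ _ FX FY.
      by exists Y; split=> //; have [sY _ _ _ _] := Fgood _ FY; apply: (sY.2) => //; apply: XY.
    by exists X; split=> //; have [sX _ _ _ _] := Fgood _ FX; apply: (sX.2) => //; apply: YX.
  + by move=> u F1u; exists X0; split=> //; have [_ F1X _ _ _] := Fgood _ FX0; apply: F1X.
  + by move=> u [X [FX Xu]]; have [_ _ XP _ _] := Fgood _ FX; apply: XP.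
  + move=> h eh u [X [FX Xu]]; exists X; split=> //.
    by have [_ _ _ stX _] := Fgood _ FX; apply: stX.
  + by move=> [X [FX Xfx]]; have [_ _ _ _ nX] := Fgood _ FX; apply: nX.
have irrP : irredV (range_in e) P1 P.
  split; first by split=> // /(_ _ Pfx).
    by move=> h eh; split; [apply: stP1|apply: stP].
  move=> Q sQ P1Q QP stQ; have F1Q : incl F1 Q by move=> u /F1P1 /P1Q.
  have [Qfx|nQfx] := pselect (Q (f x)).
    by right=> u; split=> [|Pu]; [apply: QP|apply: Pu].
  by left=> u; split=> [|P1u]; [apply: (maxP1 Q)|apply: P1Q].
apply: nP1.
have linE' h : range_in e h -> linE h by case=> /linL.
apply: (@finite_section_nilpotent _ _ (range_in e) (fun h => range_in e h /\ R h) P1 P linE'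
  (range_in_lieSub e) _ _ sP1 sP irrP #|I|.+1) => //.
- split; first by move=> h [].
    split; first by split; [case: (range_in_lieSub e) => -[]|case: sR].
    move=> a g h [eg Rg] [eh Rh]; split; first by case: (range_in_lieSub e) => -[_ + _]; apply.
    exact: (sR.2).
  move=> g h eg [eh Rh]; split; first by case: (range_in_lieSub e) => _; apply.
  by apply: LR => //; case: eg.
- by apply: locSolv_sub lsR => h [].
- move=> b Pb; apply: (span_dim_lt (e := e) sP1) => i; have [v [ev Fv]] := PE _ (Pb i).
  by exists v; split=> //; apply: F1P1.
Qed.

End Radical.

Lemma incl_anti (T : Type) (A B : T -> Prop) : incl A B -> incl B A -> A = B.
Proof. by move=> AB BA; apply/predeqP => x; split; [apply: AB|apply: BA]. Qed.
Lemma incl_trans (T : Type) (A B C : T -> Prop) : incl A B -> incl B C -> incl A C.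
Proof. by move=> AB BC x /AB /BC. Qed.
Lemma not_incl (T : Type) (A B : T -> Prop) : ~ incl A B -> exists x, A x /\ ~ B x.
Proof.
move=> nAB; apply: contrapT => nE; apply: nAB => x Ax; apply: contrapT => nBx.
by apply: nE; exists x.
Qed.

(** * Generalized flags *)

Section FlagOfFamily.
Variables (K : fieldType) (T : lmodType K) (lo up : T -> T -> Prop).
Hypotheses (slo : forall v, v <> 0 -> subspace (lo v)) (sup : forall v, v <> 0 -> subspace (up v)).
Hypothesis lo_up : forall v, v <> 0 -> incl (lo v) (up v).
Hypotheses (upv : forall v, v <> 0 -> up v v) (lov : forall v, v <> 0 -> ~ lo v v).
Hypothesis trich : forall u v, u <> 0 -> v <> 0 ->
  [\/ incl (up u) (lo v), lo u = lo v /\ up u = up v | incl (up v) (lo u)].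

(** A flag given by the pair that each nonzero vector [v] selects; [trich] says that two such pairs
    coincide or follow one another. *)
Definition flag_of (F : T -> Prop) := exists v, v <> 0 /\ (F = lo v \/ F = up v).

Lemma flag_of_pair v : v <> 0 -> isPair flag_of (lo v) (up v).
Proof.
move=> nz_v; split.
- by exists v; split; [|left].
- by exists v; split; [|right].
- by split; [apply: lo_up|move=> /(_ _ (upv nz_v)); apply: lov].
move=> H [u [nz_u [->|->]]].
  have [uv|[-> _]|vu] := trich nz_u nz_v; [left|by left|by right].
  exact: incl_trans (lo_up nz_u) uv.
have [uv|[_ ->]|vu] := trich nz_u nz_v; [by left|by right|right].
exact: incl_trans vu (lo_up nz_u).
Qed.

Lemma flag_of_pairE F1 F2 : isPair flag_of F1 F2 ->
  exists v, [/\ v <> 0, F1 = lo v & F2 = up v].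
Proof.
move=> [FF1 FF2 [F12 nF21] F12P].
have [v [F2v nF1v]] := not_incl nF21.
have nz_v : v <> 0.
  move=> v0; apply: nF1v; rewrite v0; case: FF1 => u [nz_u [->|->]].
    by case: (slo nz_u).
  by case: (sup nz_u).
have [Flo Fup _ loupP] := flag_of_pair nz_v.
exists v; split=> //; apply: incl_anti.
- by have [//|vF1] := loupP _ FF1; case: nF1v; apply/vF1/upv.
- by have [//|F2lo] := F12P _ Flo; case: (lov nz_v); apply: F2lo.
- by have [upF1|//] := F12P _ Fup; case: nF1v; apply/upF1/upv.
- by have [F2lo|//] := loupP _ FF2; case: (lov nz_v); apply: F2lo.
Qed.

Lemma flag_of_genFlag : genFlag flag_of.
Proof.
have pairP v : v <> 0 -> forall H, flag_of H -> incl H (lo v) \/ incl (up v) H.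
  by move=> nz_v; have [] := flag_of_pair nz_v.
split.
- by move=> F [v [nz_v [->|->]]]; [apply: slo|apply: sup].
- move=> F H [v [nz_v [->|->]]] /(pairP v nz_v)[Hv|vH].
  + by right.
  + by left; apply: incl_trans (lo_up nz_v) vH.
  + by right; apply: incl_trans Hv (lo_up nz_v).
  + by left.
- move=> F [v [nz_v Fv]]; exists (lo v), (up v); split; first exact: flag_of_pair.
  by case: Fv => ->; [left|right].
- move=> v nz_v; exists (lo v), (up v); split; first exact: flag_of_pair.
  by split; [apply: upv|apply: lov].
Qed.

End FlagOfFamily.

(** * The pairing *)

Section Pairing.
Variables (K : fieldType) (V W : lmodType K) (p : V -> W -> K).
Hypothesis p_linl : forall (a : K) (u v : V) (w : W), p (a *: u + v) w = a * p u w + p v w.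
Hypothesis p_linr : forall (a : K) (u : V) (w z : W), p u (a *: w + z) = a * p u w + p u z.
Hypothesis p_ndl : forall u : V, (forall w, p u w = 0) -> u = 0.
Hypothesis p_ndr : forall w : W, (forall u, p u w = 0) -> w = 0.
Implicit Types (A Q : V -> Prop) (B : W -> Prop) (f : End V) (g : End W).

Lemma pair0l w : p 0 w = 0.
Proof. by have := p_linl (-1) 0 0 w; rewrite scaler0 addr0 mulN1r addNr. Qed.
Lemma pair0r u : p u 0 = 0.
Proof. by have := p_linr (-1) u 0 0; rewrite scaler0 addr0 mulN1r addNr. Qed.
Lemma pairDl u v w : p (u + v) w = p u w + p v w.
Proof. by rewrite -[u]scale1r p_linl mul1r scale1r. Qed.
Lemma pairDr u w z : p u (w + z) = p u w + p u z.
Proof. by rewrite -[w]scale1r p_linr mul1r scale1r. Qed.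
Lemma pairZl a u w : p (a *: u) w = a * p u w.
Proof. by rewrite -[_ *: _]addr0 p_linl pair0l addr0. Qed.
Lemma pairZr a u w : p u (a *: w) = a * p u w.
Proof. by rewrite -[_ *: _]addr0 p_linr pair0r addr0. Qed.
Lemma pairNl u w : p (- u) w = - p u w.
Proof. by rewrite -scaleN1r pairZl mulN1r. Qed.
Lemma pairNr u w : p u (- w) = - p u w.
Proof. by rewrite -scaleN1r pairZr mulN1r. Qed.
Lemma pair_sumr (I : Type) (r : seq I) (F : I -> W) u :
  p u (\sum_(i <- r) F i) = \sum_(i <- r) p u (F i).
Proof. by apply: (big_morph (p u)) => [w z|]; [apply: pairDr|apply: pair0r]. Qed.
Lemma pair_suml (I : Type) (r : seq I) (F : I -> V) w :
  p (\sum_(i <- r) F i) w = \sum_(i <- r) p (F i) w.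
Proof. by apply: (big_morph (fun u => p u w)) => [u v|]; [apply: pairDl|apply: pair0l]. Qed.

Lemma perpV_mono A A' : incl A A' -> incl (perpV p A') (perpV p A).
Proof. by move=> AA w Aw u /AA; apply: Aw. Qed.
Lemma perpW_mono B B' : incl B B' -> incl (perpW p B') (perpW p B).
Proof. by move=> BB u Bu w /BB; apply: Bu. Qed.

Definition biperp A := perpW p (perpV p A).
Lemma sub_biperp A : incl A (biperp A).
Proof. by move=> u Au w; apply. Qed.
Lemma biperp_mono A A' : incl A A' -> incl (biperp A) (biperp A').
Proof. by move=> AA; apply/perpW_mono/perpV_mono. Qed.
Lemma perpV_biperp A : perpV p (biperp A) = perpV p A.
Proof. by apply: incl_anti; [apply/perpV_mono/sub_biperp|move=> w Aw u; apply]. Qed.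
Lemma biperp_perpW B : biperp (perpW p B) = perpW p B.
Proof. by apply: incl_anti; [apply: perpW_mono => w Bw u; apply|apply: sub_biperp]. Qed.
Lemma perpW_subspace B : subspace (perpW p B).
Proof.
split=> [w _|a u v Bu Bv w Bw]; first exact: pair0l.
by rewrite p_linl Bu // Bv // mulr0 addr0.
Qed.
(** The sign makes [g] the action on V_* of the same Lie algebra element, rather than the transpose
    of [f]. *)
Definition adjoint f g := forall u w, p (f u) w = - p u (g w).

Lemma adjoint_starAct f g w z : adjoint f g -> starAct p f w z <-> z = g w.
Proof.
move=> fg; split=> [wz|-> u]; last by rewrite fg opprK.
apply/eqP; rewrite -subr_eq0; apply/eqP/p_ndr => u.
by rewrite pairDr pairNr wz fg opprK subrr.
Qed.

Lemma stabW_adjoint f g B : adjoint f g -> stabW p f B <-> stabV g B.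
Proof.
move=> fg; split=> [fB w Bw|gB w z Bw /(adjoint_starAct _ _ fg) ->]; last exact: gB.
exact: fB Bw ((adjoint_starAct _ _ fg).2 erefl).
Qed.

Lemma inGl_adjoint f : inGl p f -> exists g, adjoint f g /\ inGl (fun w v => p v w) g.
Proof.
move=> [s fE]; exists (fun w => \sum_(x <- [seq (- x.2, x.1) | x <- s]) p x.2 w *: x.1).
split; last by exists [seq (- x.2, x.1) | x <- s].
move=> u w; rewrite fE big_map pair_suml pair_sumr -sumrN.
by apply: eq_bigr => x _; rewrite pairZl pairZr pairNr mulrN opprK mulrC.
Qed.

Lemma adjoint_unique f g g' : adjoint f g -> adjoint f g' -> g = g'.
Proof.
move=> fg fg'; apply/funext => w; apply/(adjoint_starAct _ _ fg').
by apply/(adjoint_starAct _ _ fg).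
Qed.

Lemma inGl_lin f : inGl p f -> linE f.
Proof.
move=> [s fE] a x y; rewrite !fE scaler_sumr -big_split; apply: eq_bigr => i _ /=.
by rewrite p_linl scalerDl scalerA.
Qed.

Lemma inGl_finrank f : inGl p f ->
  exists (I : finType) (e : I -> V), forall u, span_fam e (f u).
Proof.
move=> [s fE]; exists 'I_(size s), (fun i => (tnth (in_tuple s) i).1) => u.
by exists (fun i => p u (tnth (in_tuple s) i).2); rewrite fE big_tnth.
Qed.

Lemma stabV_perp f g A : adjoint f g -> stabV f A -> stabV g (perpV p A).
Proof. by move=> fg fA w Aw u Au; apply: oppr_inj; rewrite -fg oppr0 Aw //; apply: fA. Qed.
Lemma stabV_perpW f g B : adjoint f g -> stabV g B -> stabV f (perpW p B).
Proof. by move=> fg gB u Bu w Bw; rewrite fg Bu ?oppr0 //; apply: gB. Qed.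
Lemma stabV_biperp f A : inGl p f -> stabV f A -> stabV f (biperp A).
Proof.
by move=> /inGl_adjoint[g [fg _]] fA; apply: (stabV_perpW fg); apply: stabV_perp fA.
Qed.

(* A finite-rank [f] factors through finitely many functionals [p _ y_i]; if the
   values at [u] were not attained on [Q], some combination of the [y_i] would
   be orthogonal to [Q] but not to [u]. *)
Lemma biperp_attained f Q u : inGl p f -> subspace Q -> biperp Q u ->
  exists q, Q q /\ f q = f u.
Proof.
move=> [s fE] sQ clu; pose n := size s; pose y (i : 'I_n) := (tnth (in_tuple s) i).2.
pose ev v : 'rV[K]_n := \row_i p v (y i).
have evl a v w : ev (a *: v + w) = a *: ev v + ev w.
  by apply/rowP => i; rewrite !mxE p_linl.
suff [q [Qq qu]] : exists q, Q q /\ ev q = ev u.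
  exists q; split=> //; rewrite !fE [LHS]big_tnth [RHS]big_tnth; apply: eq_bigr => i _.
  by have /rowP/(_ i) := qu; rewrite !mxE => ->.
pose U (w : 'rV[K]_n) := exists q, Q q /\ ev q = w.
have sU : subspace U.
  split; first by exists 0; split; [case: sQ|apply/rowP => i; rewrite !mxE pair0l].
  move=> a _ _ [q [Qq <-]] [r [Qr <-]]; exists (a *: q + r).
  by split; [apply: (sQ.2)|rewrite evl].
have s0 : subspace (fun x : 'rV[K]_n => x = 0).
  by split=> // a v w -> ->; rewrite scaler0 addr0.
have [] := @basis_mod _ _ _ U #|'I_n|.+1 s0.
  move=> b Ub; apply: (span_dim_lt (e := fun j : 'I_n => delta_mx 0 j : 'rV_n)) => // i.
  exists (b i); split; last by rewrite subrr.
  by exists (fun j => b i 0 j); rewrite {1}[b i]row_sum_delta.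
move=> r [b [Ub _ Ub_gen]].
pose B : 'M_(r, n) := \matrix_i b i.
suff /submxP[c uB] : (ev u <= B)%MS.
  rewrite -/(U (ev u)) uB mulmx_sum_row; apply: subspace_sum => // i.
  by apply: subspaceZ => //; rewrite rowK.
rewrite submxE; apply/eqP/rowP => j; rewrite mxE [RHS]mxE.
(* Each column of the cokernel matrix gives a combination [z] of the functionals that vanishes on
   [Q], hence at [u]. *)
pose z := \sum_i cokermx B i j *: y i.
have pz v : p v z = \sum_i ev v 0 i * cokermx B i j.
  by rewrite pair_sumr; apply: eq_bigr => i _; rewrite pairZr mulrC [ev v _ _]mxE.
rewrite -pz; apply: clu => q Qq; rewrite pz.
have /Ub_gen[c /eqP] : U (ev q) by exists q.
rewrite subr_eq0 => /eqP qb.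
have : ev q *m cokermx B = 0.
  have -> : ev q = (\row_i c i) *m B.
    by rewrite mulmx_sum_row qb; apply: eq_bigr => i _; rewrite mxE rowK.
  by rewrite -mulmxA mulmx_coker mulmx0.
by move/rowP/(_ j); rewrite !mxE.
Qed.

(** For [v] outside [A], take [w] orthogonal to [A] with <v,w> nonzero. Correcting any [z]
    orthogonal to [A] by a multiple of [w] makes it orthogonal to [v] too, hence to [u]; so u -
    (<u,w>/<v,w>) v lies in [A]. *)
Lemma biperp_add_line A v : biperp A = A -> biperp (fun u => exists c, A (u - c *: v))
  = (fun u => exists c, A (u - c *: v)).
Proof.
move=> clA; apply: incl_anti; last exact: sub_biperp.
have sA : subspace A by rewrite -clA; apply: perpW_subspace.
move=> u clu; have [Av|nAv] := pselect (A v).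
  exists 0; rewrite scale0r subr0 -clA => w Aw; apply: clu => x [c Axv].
  by apply/Aw/(subspaceBr sA _ Axv); apply: subspaceZ.
have [w [Aw nvw]] : exists w, perpV p A w /\ ~ p v w = 0.
  apply: contrapT => nw; apply: nAv; rewrite -clA => w Aw.
  by apply: contrapT => pvw; apply: nw; exists w.
have /eqP nz_vw := nvw.
exists (p u w / p v w); rewrite -clA => z Az.
have : p u (z - (p v z / p v w) *: w) = 0.
  apply: clu => x [c Axv].
  have -> : x = (x - c *: v) + c *: v by rewrite subrK.
  rewrite pairDl !pairDr !pairNr !pairZr !pairZl (Az _ Axv) (Aw _ Axv).
  by rewrite mulr0 subrr add0r mulrCA divfK // subrr.
rewrite pairDr pairNr pairZr pairDl pairNl pairZl => <-.
by congr (_ - _); rewrite mulrAC [RHS]mulrAC [p u w * _]mulrC.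
Qed.

End Pairing.

(** * The flag of a maximal chain of closed stable subspaces *)

Section ChainFlag.
Variables (K : fieldType) (V W : lmodType K) (p : V -> W -> K).
Hypothesis p_linl : forall (a : K) (u v : V) (w : W), p (a *: u + v) w = a * p u w + p v w.
Hypothesis p_linr : forall (a : K) (u : V) (w z : W), p u (a *: w + z) = a * p u w + p u z.
Hypothesis p_ndl : forall u : V, (forall w, p u w = 0) -> u = 0.
Variable k : End V -> Prop.
Hypothesis k_gl : incl k (inGl p).
Local Notation biperp := (biperp p).

Definition stable (A : V -> Prop) := forall f, k f -> stabV f A.

(** Maximality appears in the form in which it is used: a closed stable set comparable with every
    member is a member. *)
Definition maximal_chain (C : (V -> Prop) -> Prop) :=
  [/\ forall A, C A -> biperp A = A /\ stable A,
      forall A B, C A -> C B -> incl A B \/ incl B A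
    & forall A, biperp A = A -> stable A -> (forall B, C B -> incl A B \/ incl B A) -> C A].

Lemma stable_biperp A : stable A -> stable (biperp A).
Proof. by move=> sA f kf; apply: (stabV_biperp p_linl p_linr (k_gl kf)); apply: sA. Qed.

Lemma maximal_chain_exists : exists C, maximal_chain C.
Proof.
pose good (C : (V -> Prop) -> Prop) := (forall A, C A -> biperp A = A /\ stable A) /\
  (forall A B, C A -> C B -> incl A B \/ incl B A).
have [||F _ Fgood Fch|C [[Cok Cch] Cmax]] := @Zorn_union (V -> Prop) good
  (fun A => A = (fun=> True)).
- split=> [A ->|A B -> ->]; last by left.
  by split; [apply: incl_anti => //; apply: sub_biperp|].
- by exists (fun=> True).
- split=> [A [X [FX XA]]|A B [X [FX XA]] [Y [FY YB]]]; first exact: (Fgood _ FX).1.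
  have [XY|YX] := Fch _ _ FX FY.
    by apply: (Fgood _ FY).2 => //; apply: XY.
  by apply: (Fgood _ FX).2 => //; apply: YX.
exists C; split=> // A clA sA Acmp; apply: (Cmax (fun B => C B \/ B = A)); last by right.
  split=> [B [/Cok//|->//]|B B' [CB|->] [CB'|->]].
  - exact: Cch.
  - by have [?|?] := Acmp _ CB; [right|left].
  - exact: Acmp.
  - by left.
by move=> B CB; left.
Qed.

Variable C : (V -> Prop) -> Prop.
Hypothesis maxC : maximal_chain C.

Let C_closed A : C A -> biperp A = A. Proof. by case: maxC => h _ _ /h[]. Qed.
Let C_stable A : C A -> stable A. Proof. by case: maxC => h _ _ /h[]. Qed.
Let C_chain A B : C A -> C B -> incl A B \/ incl B A.
Proof. by case: maxC => _ h _; apply: h. Qed.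
Let C_subspace A : C A -> subspace A.
Proof. by move=> /C_closed <-; apply: perpW_subspace. Qed.

Lemma biperp_in_chain A : stable A -> (forall B, C B -> incl A B \/ incl B A) -> C (biperp A).
Proof.
move=> sA Acmp; case: maxC => _ _; apply; first exact: biperp_perpW.
  exact: stable_biperp.
move=> B CB; have [AB|BA] := Acmp _ CB; [left|right].
  by rewrite -(C_closed CB); apply: biperp_mono.
exact: incl_trans BA (@sub_biperp _ _ _ _ _).
Qed.

Lemma chain0 : C (fun u => u = 0).
Proof.
case: maxC => _ _; apply.
- apply: incl_anti; last exact: sub_biperp.
  move=> u clu; apply: p_ndl => w; apply: clu => _ ->; exact: (pair0l p_linl).
- by move=> f /k_gl /(inGl_lin p_linl) lf _ ->; apply: linE0.
- by move=> B /C_subspace[B0 _]; left=> _ ->.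
Qed.

Definition chain_lo (v x : V) := exists A, [/\ C A, ~ A v & A x].
Definition chain_up (v x : V) := forall A, C A -> A v -> A x.
(* If [chain_lo v] is closed this is the socle of [chain_up v / chain_lo v];
   if it is not, [Q := chain_lo v] shows that it equals [chain_lo v]. *)
Definition chain_mid (v x : V) := chain_up v x /\
  forall Q, subspace Q -> stable Q -> incl (chain_lo v) Q ->
    (biperp (chain_lo v) = chain_lo v -> exists y, [/\ chain_up v y, Q y & ~ chain_lo v y]) -> Q x.

Section Vector.
Variable v : V.
Hypothesis nz_v : v <> 0.

Lemma chain_lo_notin : ~ chain_lo v v. Proof. by case=> A [_ nAv Av]. Qed.
Lemma chain_up_in : chain_up v v. Proof. by move=> A _. Qed.

Lemma chain_dich A : C A -> incl A (chain_lo v) \/ incl (chain_up v) A.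
Proof.
move=> CA; have [Av|nAv] := pselect (A v); first by right=> x; apply.
by left=> x Ax; exists A.
Qed.

Lemma chain_lo_up : incl (chain_lo v) (chain_up v).
Proof.
move=> x [A [CA nAv Ax]] B CB Bv; have [AB|BA] := C_chain CA CB; first exact: AB.
by case: nAv; apply: BA.
Qed.

Lemma chain_lo_subspace : subspace (chain_lo v).
Proof.
split; first by exists (fun u => u = 0); split=> //; apply: chain0.
move=> a x y [A [CA nAv Ax]] [B [CB nBv By]].
have [AB|BA] := C_chain CA CB.
  by exists B; split=> //; apply: (C_subspace CB).2 => //; apply: AB.
by exists A; split=> //; apply: (C_subspace CA).2 => //; apply: BA.
Qed.

Lemma chain_up_subspace : subspace (chain_up v).
Proof.
split=> [A /C_subspace[]//|a x y ux uy A CA Av].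
by apply: (C_subspace CA).2; [apply: ux|apply: uy].
Qed.

Lemma chain_lo_stable : stable (chain_lo v).
Proof. by move=> f kf x [A [CA nAv Ax]]; exists A; split=> //; apply: C_stable kf _ Ax. Qed.
Lemma chain_up_stable : stable (chain_up v).
Proof. by move=> f kf x ux A CA Av; apply: (C_stable CA kf); apply: ux. Qed.
Lemma chain_up_closed : biperp (chain_up v) = chain_up v.
Proof.
apply: incl_anti; last exact: sub_biperp.
move=> x clx A CA Av; rewrite -(C_closed CA); apply: biperp_mono clx => y; exact.
Qed.

Lemma chain_lo_mid : incl (chain_lo v) (chain_mid v).
Proof. by move=> x lx; split=> [|Q _ _ + _]; [apply: chain_lo_up|apply]. Qed.
Lemma chain_mid_up : incl (chain_mid v) (chain_up v). Proof. by move=> x []. Qed.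
Lemma chain_mid_subspace : subspace (chain_mid v).
Proof.
split; first by apply: chain_lo_mid; case: chain_lo_subspace.
move=> a x y [ux mx] [uy my]; split; first exact: chain_up_subspace.2.
by move=> Q sQ stQ lQ hQ; apply: (sQ.2); [apply: mx|apply: my].
Qed.
Lemma chain_mid_stable : stable (chain_mid v).
Proof.
move=> f kf x [ux mx]; split; first exact: chain_up_stable.
by move=> Q sQ stQ lQ hQ; apply: (stQ f kf); apply: mx.
Qed.
Lemma chain_mid_nonclosed : biperp (chain_lo v) <> chain_lo v -> chain_mid v = chain_lo v.
Proof.
move=> ncl; apply: incl_anti; last exact: chain_lo_mid.
move=> x [_ mx]; apply: mx => //; [exact: chain_lo_subspace|exact: chain_lo_stable].
Qed.

(** Lying in the gap at [v], [Q] is comparable with every member, so its closure belongs to [C]; a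
    member not inside [chain_lo v] contains [chain_up v]. *)
Lemma chain_between_dense Q : stable Q -> incl (chain_lo v) Q -> incl Q (chain_up v) ->
  ~ incl (biperp Q) (chain_lo v) -> biperp Q = chain_up v.
Proof.
move=> stQ lQ Qu nQl.
have CQ : C (biperp Q).
  apply: biperp_in_chain => // B /chain_dich[Bl|uB]; [right|left].
    exact: incl_trans Bl lQ.
  exact: incl_trans Qu uB.
apply: incl_anti; first by rewrite -chain_up_closed; apply: biperp_mono.
by case: (chain_dich CQ).
Qed.

(* Either [k] maps [chain_up v] into [chain_lo v], and then [chain_up v] is
   spanned by [v] over [chain_lo v]; or some [f u] lies outside [chain_lo v], and
   by density [f u] lies in every intermediate stable subspace. *)
Lemma chain_mid_proper : biperp (chain_lo v) = chain_lo v -> ~ incl (chain_mid v) (chain_lo v).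
Proof.
move=> cl_lo mid_lo.
have slo := chain_lo_subspace.
have [[f [u [kf uu nlfu]]]|triv] :=
  pselect (exists f u, [/\ k f, chain_up v u & ~ chain_lo v (f u)]).
  apply/nlfu/mid_lo; split; first exact: chain_up_stable.
  move=> Q sQ stQ lQ /(_ cl_lo)[y [uy Qy nly]].
  (* Cutting [Q] down to the gap makes it dense in [chain_up v], so the value [f u] is attained on
     it. *)
  pose Q' x := Q x /\ chain_up v x.
  have sQ' : subspace Q'.
    split; first by split; [case: sQ|case: chain_up_subspace].
    by move=> a x z [Qx ux] [Qz uz]; split; [apply: (sQ.2)|apply: chain_up_subspace.2].
  have clQ' : biperp Q' = chain_up v.
    apply: chain_between_dense.
    - by move=> g kg x [Qx ux]; split; [apply: stQ|apply: chain_up_stable].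
    - by move=> x lx; split; [apply: lQ|apply: chain_lo_up].
    - by move=> x [].
    - by move=> h; apply/nly/h/sub_biperp.
  have [|q [[Qq _] <-]] := biperp_attained p_linl p_linr (k_gl kf) sQ' (_ : biperp Q' u).
    by rewrite clQ'.
  exact: stQ.
have loK f x : k f -> chain_up v x -> chain_lo v (f x).
  by move=> kf ux; apply: contrapT => nl; apply: triv; exists f, x.
pose line x := exists c : K, chain_lo v (x - c *: v).
have lo_line : incl (chain_lo v) line by move=> x lx; exists 0; rewrite scale0r subr0.
have line_up : incl line (chain_up v).
  move=> x [c /chain_lo_up ux]; apply: (subspaceBr chain_up_subspace _ ux).
  exact: (@subspaceZ _ _ (chain_up v) c v chain_up_subspace chain_up_in).
have line_v : line v by exists 1; rewrite scale1r subrr; case: slo.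
have up_line : chain_up v = line.
  have := biperp_add_line p_linl p_linr v cl_lo; rewrite -/line => <-.
  apply/esym/chain_between_dense => //.
    by move=> f kf x /line_up ux; apply/lo_line/loK.
  by move=> h; apply: chain_lo_notin; apply/h/sub_biperp.
apply/chain_lo_notin/mid_lo; split=> // Q sQ stQ lQ /(_ cl_lo)[y []].
rewrite up_line => -[c lyc] Qy nly.
have nz_c : c != 0 by apply: contra_notN nly => /eqP c0; rewrite c0 scale0r subr0 in lyc.
have : Q (c *: v) by rewrite -[c *: v](subKr y); apply: subspaceB => //; apply: lQ.
by move=> /(subspaceZ c^-1 sQ); rewrite scalerA mulVf // scale1r.
Qed.

Lemma chain_mid_irred : biperp (chain_lo v) = chain_lo v -> irredV k (chain_lo v) (chain_mid v).
Proof.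
move=> cl_lo; split.
- by split; [apply: chain_lo_mid|apply: chain_mid_proper].
- by move=> f kf; split; [apply: chain_lo_stable|apply: chain_mid_stable].
move=> M sM lM Mmid stM.
have [Ml|/not_incl[y [My nly]]] := pselect (incl M (chain_lo v)).
  by left=> x; split; [apply: Ml|apply: lM].
right=> x; split; [exact: Mmid|move=> [_]; apply=> // _].
by exists y; split=> //; case: (Mmid y My).
Qed.

Lemma chain_mid_dense : ~ chain_mid v v -> biperp (chain_mid v) = chain_up v.
Proof.
move=> nmv; apply: chain_between_dense.
- exact: chain_mid_stable.
- exact: chain_lo_mid.
- exact: chain_mid_up.
(* A closed [chain_lo v] is properly contained in the socle. Otherwise [chain_mid v] equals
   [chain_lo v], and a closure inside it would make it closed. *)
move=> cl_mid; have [cl|ncl] := pselect (biperp (chain_lo v) = chain_lo v).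
  by apply: (chain_mid_proper cl) => x /(@sub_biperp _ _ _ p) /cl_mid.
rewrite (chain_mid_nonclosed ncl) in cl_mid.
by apply: ncl; apply: incl_anti; [|apply: sub_biperp].
Qed.

End Vector.

Lemma chain_trich u v : [\/ incl (chain_up u) (chain_lo v),
  chain_lo u = chain_lo v /\ chain_up u = chain_up v | incl (chain_up v) (chain_lo u)].
Proof.
have lt x y : chain_lo y x -> incl (chain_up x) (chain_lo y).
  by move=> [A [CA nAy Ax]] z /(_ A CA Ax) Az; exists A.
have [/lt|nvu] := pselect (chain_lo v u); first by constructor 1.
have [/lt|nuv] := pselect (chain_lo u v); first by constructor 3.
constructor 2.
have uv A : C A -> A u <-> A v.
  by move=> CA; split=> Ax; apply: contrapT => nA; [apply: nvu|apply: nuv]; exists A.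
split; apply/predeqP => x.
  by split=> -[A [CA nA Ax]]; exists A; split=> //; move/(uv A CA).
by split=> ux A CA /(uv A CA) /(ux A CA).
Qed.

(** Of the two steps from [chain_lo v] to [chain_mid v] to [chain_up v], the pair selected is the
    one whose gap contains [v]; trivial steps are never selected. *)
Definition flag_lo v := if `[< chain_mid v v >] then chain_lo v else chain_mid v.
Definition flag_up v := if `[< chain_mid v v >] then chain_mid v else chain_up v.
Definition chain_flag := flag_of flag_lo flag_up.

Lemma chain_lo_flag_lo v : v <> 0 -> incl (chain_lo v) (flag_lo v).
Proof. by move=> nz_v; rewrite /flag_lo; case: asboolP => _ x; [|apply: chain_lo_mid]. Qed.
Lemma flag_up_chain_up v : v <> 0 -> incl (flag_up v) (chain_up v).
Proof. by move=> nz_v; rewrite /flag_up; case: asboolP => _ x; [apply: chain_mid_up|]. Qed.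
Lemma flag_lo_up v : v <> 0 -> incl (flag_lo v) (flag_up v).
Proof.
by rewrite /flag_lo /flag_up; case: asboolP => _ nz_v; [apply: chain_lo_mid|apply: chain_mid_up].
Qed.
Lemma flag_up_in v : flag_up v v.
Proof. by rewrite /flag_up; case: asboolP => // _; apply: chain_up_in. Qed.
Lemma flag_lo_notin v : ~ flag_lo v v.
Proof. by rewrite /flag_lo; case: asboolP => // _; apply: chain_lo_notin. Qed.
Lemma flag_lo_subspace v : v <> 0 -> subspace (flag_lo v).
Proof.
rewrite /flag_lo; case: asboolP => _ nz_v; first exact: chain_lo_subspace.
exact: chain_mid_subspace.
Qed.
Lemma flag_up_subspace v : v <> 0 -> subspace (flag_up v).
Proof.
rewrite /flag_up; case: asboolP => _ nz_v; first exact: chain_mid_subspace.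
exact: chain_up_subspace.
Qed.

Lemma flag_trich u v : u <> 0 -> v <> 0 ->
  [\/ incl (flag_up u) (flag_lo v), flag_lo u = flag_lo v /\ flag_up u = flag_up v
    | incl (flag_up v) (flag_lo u)].
Proof.
move=> nz_u nz_v; have [uv|[lo_eq up_eq]|vu] := chain_trich u v.
- constructor 1; apply: incl_trans (chain_lo_flag_lo nz_v).
  exact: incl_trans (flag_up_chain_up nz_u) uv.
- have mid_eq : chain_mid u = chain_mid v by rewrite /chain_mid lo_eq up_eq.
  rewrite /flag_lo /flag_up mid_eq lo_eq up_eq.
  case: asboolP => mu; case: asboolP => mv; by [constructor 1|constructor 2|constructor 3].
- constructor 3; apply: incl_trans (chain_lo_flag_lo nz_u).
  exact: incl_trans (flag_up_chain_up nz_v) vu.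
Qed.

Lemma chain_flag_pairE F1 F2 : isPair chain_flag F1 F2 ->
  exists v, [/\ v <> 0, F1 = flag_lo v & F2 = flag_up v].
Proof.
apply: flag_of_pairE => // [v|v|v|v _|v _|].
- exact: flag_lo_subspace.
- exact: flag_up_subspace.
- exact: flag_lo_up.
- exact: flag_up_in.
- exact: flag_lo_notin.
- exact: flag_trich.
Qed.

Lemma chain_flag_semiclosed : semiclosedV p chain_flag.
Proof.
split.
  apply: flag_of_genFlag => // [v|v|v|v _|v _|].
  - exact: flag_lo_subspace.
  - exact: flag_up_subspace.
  - exact: flag_lo_up.
  - exact: flag_up_in.
  - exact: flag_lo_notin.
  - exact: flag_trich.
move=> F1 F2 /chain_flag_pairE[v [nz_v -> ->]]; rewrite /flag_lo /flag_up.
case: asboolP => mv; [left|right]; apply/predeqP; last exact: chain_mid_dense.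
apply: contrapT => ncl; rewrite (chain_mid_nonclosed nz_v ncl) in mv.
exact: chain_lo_notin mv.
Qed.

Lemma chain_flag_stable F : chain_flag F -> stable F.
Proof.
case=> v [nz_v [->|->]]; rewrite /flag_lo /flag_up; case: asboolP => _.
- exact: chain_lo_stable.
- exact: chain_mid_stable.
- exact: chain_mid_stable.
- exact: chain_up_stable.
Qed.

Lemma chain_flag_irred F1 F2 : isPair chain_flag F1 F2 -> closedV p F1 -> irredV k F1 F2.
Proof.
move=> /chain_flag_pairE[v [nz_v -> ->]]; rewrite /flag_lo /flag_up.
case: asboolP => mv /predeqP cl; first exact: chain_mid_irred.
(* A closed [chain_mid v] equals its closure [chain_up v], which contains [v]; so only pairs
   starting at [chain_lo v] remain. *)
have mid_up : chain_mid v = chain_up v by rewrite -(chain_mid_dense nz_v mv) -[LHS]cl.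
by case: mv; rewrite mid_up; apply: chain_up_in.
Qed.

Lemma chain_flag_biperp F : chain_flag F -> C (biperp F).
Proof.
move=> FF; apply: biperp_in_chain; first exact: chain_flag_stable.
move=> B CB; case: FF => v [nz_v FE].
have [Bl|uB] := chain_dich v CB; [right|left].
  apply: (incl_trans Bl); case: FE => ->; first exact: chain_lo_flag_lo.
  exact: incl_trans (chain_lo_flag_lo nz_v) (flag_lo_up nz_v).
apply: incl_trans uB; case: FE => ->; last exact: flag_up_chain_up.
exact: incl_trans (flag_lo_up nz_v) (flag_up_chain_up nz_v).
Qed.

(** Each nonzero [u] in a member [A] has [flag_up u] inside [A], so stabilizing the flag stabilizes
    the chain. Tautness rests on this. *)
Lemma chain_flag_stabV f : linE f -> (forall F, chain_flag F -> stabV f F) ->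
  forall A, C A -> stabV f A.
Proof.
move=> lf stF A CA u Au; have [->|nz_u] := pselect (u = 0).
  by rewrite linE0 //; case: (C_subspace CA).
have : flag_up u (f u) by apply: stF (flag_up_in u); exists u; split; [|right].
by move=> /(flag_up_chain_up nz_u); apply.
Qed.

End ChainFlag.

(** * The nilradical of the stabilizer *)

Section StrictOperators.
Variables (K : fieldType) (V : lmodType K) (Fl : (V -> Prop) -> Prop).
Hypothesis flagF : genFlag Fl.

Definition strictE (h : End V) := forall F1 F2, isPair Fl F1 F2 -> forall u, F2 u -> F1 (h u).

Lemma genFlag_top (s : seq V) : (forall x, x \in s -> x = 0) \/
  exists F1 F2, [/\ isPair Fl F1 F2, forall x, x \in s -> F2 x & exists x, x \in s /\ ~ F1 x].
Proof.
have [sFl _ _ Flv] := flagF; elim: s => [|a s [s0|[F1 [F2 [F12 sF2 [x [xs nF1x]]]]]]].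
- by left.
- have [->|nz_a] := pselect (a = 0).
    by left=> x; rewrite in_cons => /orP[/eqP|/s0].
  have [A1 [A2 [A12 [A2a nA1a]]]] := Flv _ nz_a; right; exists A1, A2; split=> //.
    move=> x; rewrite in_cons => /orP[/eqP->//|/s0->].
    by have [_ /sFl[]] := A12.
  by exists a; rewrite mem_head.
- right; have xas : x \in a :: s by rewrite in_cons xs orbT.
  have [->|nz_a] := pselect (a = 0).
    exists F1, F2; split=> //; last by exists x; rewrite in_cons xs orbT.
    move=> y; rewrite in_cons => /orP[/eqP->|/sF2//].
    by have [_ /sFl[]] := F12.
  have [A1 [A2 [A12 [A2a nA1a]]]] := Flv _ nz_a.
  have [_ FA2 _ _] := A12; have [_ _ [F1F2 _] /(_ _ FA2)[A2F1|F2A2]] := F12.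
    exists F1, F2; split=> //; last by exists x.
    by move=> y; rewrite in_cons => /orP[/eqP->|/sF2//]; apply/F1F2/A2F1.
  exists A1, A2; split=> //; last by exists a; rewrite mem_head.
  by move=> y; rewrite in_cons => /orP[/eqP->//|/sF2 /F2A2].
Qed.

Let zero_subspace : subspace (fun x : V => x = 0).
Proof. by split=> // a x y -> ->; rewrite scaler0 addr0. Qed.

(** Let (F1, F2) be the topmost pair met by a basis of [U], and U' the intersection of [U] and [F1].
    Some basis vector is outside [F1], so the dimension drops, while strict operators map [F2] into
    [F1]. *)
Lemma strict_step (U : V -> Prop) n : subspace U -> dim_lt_mod (fun x => x = 0) U n.+1 ->
  (forall u, U u -> u = 0) \/
  exists U', [/\ subspace U', incl U' U, dim_lt_mod (fun x => x = 0) U' n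
    & forall h u, strictE h -> U u -> U (h u) -> U' (h u)].
Proof.
move=> sU dimU; have [sFl _ _ _] := flagF.
have [r [b [Ub _ bU]]] := basis_mod zero_subspace dimU.
have bU' F u : subspace F -> (forall i, F (b i)) -> U u -> F u.
  move=> sF Fb /bU[c /eqP]; rewrite subr_eq0 => /eqP ->.
  by apply: subspace_sum => // i; apply: subspaceZ.
have [b0|[F1 [F2 [F12 bF2 [x [/mapP[i0 _ xE] nF1x]]]]]] := genFlag_top [seq b i | i : 'I_r].
  left=> u Uu; apply: (bU' (fun x => x = 0) u zero_subspace _ Uu) => i.
  by apply/b0/map_f; rewrite mem_enum.
have [FF1 FF2 _ _] := F12; have sF1 := sFl _ FF1; have sF2 := sFl _ FF2.
right; exists (fun u => U u /\ F1 u); split.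
- split; first by split; [case: sU|case: sF1].
  by move=> a u v [Uu Fu] [Uv Fv]; split; [apply: (sU.2)|apply: (sF1.2)].
- by move=> u [].
- move=> e Ue.
  have [|c [[i ci]]] := dimU (fun i => if unlift ord0 i is Some j then e j else b i0).
    by move=> i; case: unliftP => // j _; case: (Ue j).
  rewrite big_ord_recl unlift_none.
  under eq_bigr do rewrite liftK.
  have [c0 | nz_c0] := eqVneq (c ord0) 0.
    rewrite c0 scale0r add0r => ce0; exists (fun j => c (lift ord0 j)).
    split=> //; case: (unliftP ord0 i) ci => [j ->|->]; by [exists j|rewrite c0].
  move=> ce0; case: nF1x; rewrite xE.
  have : F1 (c ord0 *: b i0).
    apply: (subspaceBr (y := - \sum_(j < n) c (lift ord0 j) *: e j) sF1); last first.
      by rewrite opprK ce0; case: sF1.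
    apply: subspaceN => //; apply: subspace_sum => // j; apply: subspaceZ => //.
    by case: (Ue j).
  by move=> /(subspaceZ (c ord0)^-1 sF1); rewrite scalerA mulVf // scale1r.
- move=> h u strict_h Uu Uhu; split=> //; apply: (strict_h _ _ F12 _ _).
  by apply: bU' Uu => // i; apply/bF2/map_f; rewrite mem_enum.
Qed.

Definition strict_into (U : V -> Prop) (h : End V) :=
  [/\ linE h, strictE h & forall u, U (h u)].

Lemma strict_into_subspace U : subspace U -> subspaceE (strict_into U).
Proof.
have [sFl _ _ _] := flagF; move=> sU; split.
  split; first by move=> a x y; rewrite /zeroE scaler0 addr0.
    by move=> F1 F2 [/sFl[F10 _] _ _ _].
  by case: sU.
move=> a f g [lf sf Uf] [lg sg Ug]; split.
- move=> c x y; rewrite /addE /scaleE lf lg !scalerDr !scalerA mulrC -!addrA.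
  by congr (_ + _); rewrite addrCA.
- move=> F1 F2 F12 u F2u; have [/sFl sF1 _ _ _] := F12.
  by apply: (sF1.2); [apply: (sf _ _ F12 _ F2u)|apply: (sg _ _ F12 _ F2u)].
- by move=> u; apply: (sU.2).
Qed.

Lemma linE_bracket (f g : End V) : linE f -> linE g -> linE (bracket f g).
Proof.
move=> lf lg a x y; rewrite /bracket lf lg lf lg scalerBr opprD !addrA; congr (_ + _).
by rewrite addrAC.
Qed.

Lemma strictE_bracket (f g : End V) : strictE f -> strictE g -> strictE (bracket f g).
Proof.
have [sFl _ _ _] := flagF; move=> sf sg F1 F2 F12 u F2u.
have [/sFl sF1 _ [F1F2 _] _] := F12.
apply: subspaceB => //; [apply: (sf _ _ F12 _ _)|apply: (sg _ _ F12 _ _)]; apply: F1F2.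
  exact: (sg _ _ F12 _ F2u).
exact: (sf _ _ F12 _ F2u).
Qed.

Lemma strict_into_bracket U f g : subspace U -> strict_into U f -> strict_into U g ->
  strict_into U (bracket f g).
Proof.
move=> sU [lf sf Uf] [lg sg Ug]; split; first exact: linE_bracket.
  exact: strictE_bracket.
by move=> u; apply: subspaceB.
Qed.

(** Brackets apply one operator after another has mapped into [U], so the derived space maps into
    the smaller U' of [strict_step]; induction on dimension follows. *)
Lemma strict_into_solvable n U S : subspace U -> dim_lt_mod (fun x => x = 0) U n ->
  incl S (strict_into U) -> forall f, iter n (@derived K V) S f -> f = @zeroE K V.
Proof.
elim: n U S => [|n IHn] U S sU dimU SU f Sf.
  have U0 (i : 'I_0) : U 0 by case: i.
  by have [c [[[]]]] := dimU (fun=> 0) U0.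
have [U_0|[U' [sU' U'U dimU' UU']]] := strict_step sU dimU.
  have [|_ _ Uf] := iter_derived_sub (strict_into_subspace sU) _ SU Sf.
    by move=> g h; apply: strict_into_bracket.
  by apply/funext => u; apply: U_0.
apply: (IHn U' (derived S) sU' dimU'); last by rewrite -iterSr.
apply: derived_sub; first exact: strict_into_subspace.
move=> g h /SU Ug /SU Uh; have [lgh sgh Ugh] := strict_into_bracket sU Ug Uh.
have [lg sg Ug'] := Ug; have [lh sh Uh'] := Uh.
by split=> // u; apply: subspaceB => //; apply: UU'.
Qed.

Lemma strict_locSolv (S : End V -> Prop) : (forall f, S f -> linE f) -> incl S strictE ->
  (forall f, S f -> exists (I : finType) (e : I -> V), forall u, span_fam e (f u)) -> locSolv S.
Proof.
move=> linS strS finS n g Sg.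
have [I [e ge]] : exists (I : finType) (e : I -> V),
    forall i, (i < n)%N -> forall u, span_fam e (g i u).
  elim: n Sg => [|n IHn] Sg; first by exists 'I_0, (fun=> 0).
  have [I [e ge]] := IHn (fun i lt_in => Sg i (ltnW lt_in)).
  have [J [d gd]] := finS _ (Sg n (leqnn _)).
  exists (I + J)%type, (cat_fam e d) => i; rewrite ltnS leq_eqVlt => /orP[/eqP->|lt_in] u.
    exact: span_fam_catr.
  by apply/span_fam_catl/ge.
have se := span_fam_subspace e.
exists #|I|.+1; apply: (strict_into_solvable se) => [b eb|f].
  apply: (span_dim_lt (e := e) zero_subspace) => i.
  by exists (b i); rewrite subrr.
apply; first by split; [apply: strict_into_subspace|move=> *; apply: strict_into_bracket].
move=> i lt_in; have Si := Sg i lt_in.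
by split; [exact: linS|exact: strS|exact: ge].
Qed.

End StrictOperators.

(** * The stabilizer of two flags and its locally solvable ideal *)

Section StabilizerAlgebra.
Variables (K : fieldType) (V W : lmodType K) (p : V -> W -> K).
Hypothesis p_linl : forall (a : K) (u v : V) (w : W), p (a *: u + v) w = a * p u w + p v w.
Hypothesis p_linr : forall (a : K) (u : V) (w z : W), p u (a *: w + z) = a * p u w + p u z.
Hypothesis p_ndr : forall w : W, (forall u, p u w = 0) -> w = 0.

Lemma inGl_subspaceE : subspaceE (inGl p).
Proof.
split; first by exists [::] => u; rewrite big_nil.
move=> a f g [s fE] [t gE]; exists ([seq (a *: x.1, x.2) | x <- s] ++ t) => u.
rewrite big_cat big_map /addE /scaleE fE gE scaler_sumr; congr (_ + _).
by apply: eq_bigr => x _ /=; rewrite !scalerA mulrC.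
Qed.

Lemma inGl_comp f g : inGl p f -> inGl p g -> inGl p (f \o g).
Proof.
move=> [s fE] /(inGl_adjoint p_linl p_linr)[g' [gg' _]].
exists [seq (x.1, - g' x.2) | x <- s] => u; rewrite /= fE big_map.
by apply: eq_bigr => x _ /=; rewrite (pairNr p_linr) gg'.
Qed.

Lemma inGl_bracket f g : inGl p f -> inGl p g -> inGl p (bracket f g).
Proof.
move=> Gf Gg; have := inGl_subspaceE.2 (-1) _ _ (inGl_comp Gg Gf) (inGl_comp Gf Gg).
by congr inGl; apply/funext => u; rewrite /addE /scaleE scaleN1r addrC.
Qed.

Lemma adjoint_scale_add a f g f' g' : adjoint p f f' -> adjoint p g g' ->
  adjoint p (addE (scaleE a f) g) (addE (scaleE a f') g').
Proof. by move=> ff' gg' u w; rewrite p_linl p_linr ff' gg' opprD mulrN. Qed.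

Lemma adjoint_bracket f g f' g' : adjoint p f f' -> adjoint p g g' ->
  adjoint p (bracket f g) (bracket f' g').
Proof.
move=> ff' gg' u w; rewrite !(pairDl p_linl, pairDr p_linr, pairNl p_linl, pairNr p_linr).
by rewrite !(ff', gg') !opprK opprB addrC.
Qed.

Variables (Fl : (V -> Prop) -> Prop) (Gl : (W -> Prop) -> Prop).
Hypotheses (sFl : forall F, Fl F -> subspace F) (sGl : forall G, Gl G -> subspace G).
Definition St (f : End V) := StV p Fl f /\ StW p Gl f.

Lemma St_gl f : St f -> inGl p f. Proof. by case=> -[]. Qed.

Lemma StE f f' : adjoint p f f' -> St f <->
  [/\ inGl p f, forall F, Fl F -> stabV f F & forall G, Gl G -> stabV f' G].
Proof.
move=> ff'; split=> [[[Gf fF] [_ fG]]|[Gf fF fG]].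
  by split=> // G GG; exact/(stabW_adjoint p_linr p_ndr _ ff')/(fG G GG).
by split; split=> // G GG; exact/(stabW_adjoint p_linr p_ndr _ ff')/(fG G GG).
Qed.

Lemma St_lieSub : lieSub St.
Proof.
split; first split.
- have z0 : adjoint p (@zeroE K V) (@zeroE K W).
    by move=> u w; rewrite (pair0l p_linl) (pair0r p_linr) oppr0.
  apply/(StE z0); split; first exact: inGl_subspaceE.1.
    by move=> F /sFl[F0 _] u.
  by move=> G /sGl[G0 _] u.
- move=> a f g Sf Sg.
  have [f' [ff' _]] := inGl_adjoint p_linl p_linr (St_gl Sf).
  have [g' [gg' _]] := inGl_adjoint p_linl p_linr (St_gl Sg).
  have [Gf fF fG] := (StE ff').1 Sf; have [Gg gF gG] := (StE gg').1 Sg.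
  apply/(StE (adjoint_scale_add a ff' gg')); split; first exact: inGl_subspaceE.2.
    move=> F FF u Fu; have sF := sFl FF.
    by apply: (sF.2); [apply: fF|apply: gF].
  move=> G GG u Gu; have sG := sGl GG.
  by apply: (sG.2); [apply: fG|apply: gG].
- move=> f g Sf Sg.
  have [f' [ff' _]] := inGl_adjoint p_linl p_linr (St_gl Sf).
  have [g' [gg' _]] := inGl_adjoint p_linl p_linr (St_gl Sg).
  have [Gf fF fG] := (StE ff').1 Sf; have [Gg gF gG] := (StE gg').1 Sg.
  apply/(StE (adjoint_bracket ff' gg')); split; first exact: inGl_bracket.
    move=> F FF u Fu; apply: subspaceB; first exact: sFl.
      by apply: fF => //; apply: gF.
    by apply: gF => //; apply: fF.
  move=> G GG u Gu; apply: subspaceB; first exact: sGl.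
    by apply: fG => //; apply: gG.
  by apply: gG => //; apply: fG.
Qed.

Hypothesis scF : semiclosedV p Fl.

(** The ideal N. Strictness is demanded only over closed [F1], where irreducibility can deliver
    it. *)
Definition St_nil (f : End V) := St f /\
  forall F1 F2, isPair Fl F1 F2 -> closedV p F1 -> forall u, F2 u -> F1 (f u).

(* On a pair with [F1] dense in [F2], finite rank forces [f F2 = f F1]. *)
Lemma St_nil_strict f : St_nil f -> strictE Fl f.
Proof.
move=> [Sf fN] F1 F2 F12 u F2u; have [FF1 _ _ _] := F12.
have [cl|dense] := scF.2 _ _ F12; first exact: (fN _ _ F12 cl _ F2u).
have clu : biperp p F1 u by apply/dense.
have [q [F1q <-]] := biperp_attained p_linl p_linr (St_gl Sf) (sFl FF1) clu.
by case: Sf => -[_ fF] _; apply: fF.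
Qed.

Lemma St_nil_ideal : ideal St St_nil.
Proof.
have [[S0 SD] SB] := St_lieSub; split; first by move=> f [].
  split.
    by split=> // F1 F2 [FF1 _ _ _] _ u _; case: (sFl FF1).
  move=> a f g [Sf fN] [Sg gN]; split; first exact: SD.
  move=> F1 F2 F12 cl u F2u; have [/sFl sF1 _ _ _] := F12.
  by apply: (sF1.2); [apply: (fN _ _ F12 cl _ F2u)|apply: (gN _ _ F12 cl _ F2u)].
move=> f g Sf [Sg gN]; split; first exact: SB.
move=> F1 F2 F12 cl u F2u; have [FF1 FF2 _ _] := F12; have [[_ fF] _] := Sf.
apply: subspaceB; first exact: sFl.
  by apply: fF => //; apply: (gN _ _ F12 cl _ F2u).
by apply: (gN _ _ F12 cl _ _); apply: fF.
Qed.

Lemma St_nil_locSolv : locSolv St_nil.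
Proof.
apply: (strict_locSolv scF.1) => [f [/St_gl Gf _]|f|f [/St_gl Gf _]].
- exact: inGl_lin Gf.
- exact: St_nil_strict.
- exact: inGl_finrank Gf.
Qed.

End StabilizerAlgebra.

(** * The couple of flags *)

Section DualChain.
Variables (K : fieldType) (V W : lmodType K) (p : V -> W -> K).
Hypothesis p_linl : forall (a : K) (u v : V) (w : W), p (a *: u + v) w = a * p u w + p v w.
Hypothesis p_linr : forall (a : K) (u : V) (w z : W), p u (a *: w + z) = a * p u w + p u z.
Hypothesis p_ndl : forall u : V, (forall w, p u w = 0) -> u = 0.
Hypothesis p_ndr : forall w : W, (forall u, p u w = 0) -> w = 0.
Variable k : End V -> Prop.
Hypothesis k_gl : incl k (inGl p).
Let q (w : W) (v : V) := p v w.

Definition dual_ops (g : End W) := exists f, k f /\ adjoint p f g.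
Definition dual_chain (C : (V -> Prop) -> Prop) (B : W -> Prop) :=
  exists A, C A /\ B = perpV p A.

Lemma dual_ops_gl : incl dual_ops (inGl q).
Proof.
move=> g [f [kf fg]]; have [g' [fg' Gg']] := inGl_adjoint p_linl p_linr (k_gl kf).
by rewrite (adjoint_unique p_linr p_ndr fg fg').
Qed.

Lemma dual_ops_stable B : stable dual_ops B <-> forall f, k f -> stabW p f B.
Proof.
split=> [sB f kf|sB g [f [kf fg]]].
  have [g [fg _]] := inGl_adjoint p_linl p_linr (k_gl kf).
  by apply/(stabW_adjoint p_linr p_ndr _ fg)/sB; exists f.
by apply/(stabW_adjoint p_linr p_ndr _ fg)/sB.
Qed.

(** Perpendiculars exchange closed stable subspaces of the two sides and reverse inclusion, so
    maximality transfers. *)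
Lemma dual_maximal_chain C : maximal_chain p k C -> maximal_chain q dual_ops (dual_chain C).
Proof.
move=> [Cok Cch Cmax]; split.
- move=> _ [A [CA ->]]; split; first exact: (perpV_biperp p A).
  by move=> g [f [kf fg]]; apply: (stabV_perp fg); apply: (Cok A CA).2.
- move=> _ _ [A [CA ->]] [A' [CA' ->]].
  by have [AA'|A'A] := Cch _ _ CA CA'; [right|left]; apply: perpV_mono.
move=> B clB stB Bcmp; exists (perpW p B); split; last exact/esym.
apply: Cmax; first exact: biperp_perpW.
  move=> f kf; have [g [fg _]] := inGl_adjoint p_linl p_linr (k_gl kf).
  by apply: (stabV_perpW fg); apply: stB; exists f.
move=> A CA; have [clA _] := Cok A CA; rewrite -clA.
have [BA|AB] : incl B (perpV p A) \/ incl (perpV p A) B by apply: Bcmp; exists A.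
  by right; apply: perpW_mono.
by left; apply: perpW_mono.
Qed.

Lemma dual_chain_perpW C B : maximal_chain p k C -> dual_chain C B -> C (perpW p B).
Proof. by move=> [Cok _ _] [A [CA ->]]; have [clA _] := Cok A CA; rewrite -/(biperp p A) clA. Qed.

End DualChain.

(** * Existence of the couple and the upper bound for nilradicals *)

Section Couple.
Variables (K : numClosedFieldType) (V W : lmodType K) (p : V -> W -> K).
Hypothesis p_linl : forall (a : K) (u v : V) (w : W), p (a *: u + v) w = a * p u w + p v w.
Hypothesis p_linr : forall (a : K) (u : V) (w z : W), p u (a *: w + z) = a * p u w + p u z.
Hypothesis p_ndl : forall u : V, (forall w, p u w = 0) -> u = 0.
Hypothesis p_ndr : forall w : W, (forall u, p u w = 0) -> w = 0.

Lemma irreducible_couple (k : End V -> Prop) : incl k (inGl p) -> exists Fl Gl,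
  [/\ taut p Fl Gl, incl k (St p Fl Gl),
      forall F1 F2, isPair Fl F1 F2 -> closedV p F1 -> irredV k F1 F2
    & forall G1 G2, isPair Gl G1 G2 -> closedW p G1 -> irredW p k G1 G2].
Proof.
move=> k_gl; pose q (w : W) (v : V) := p v w.
have q_linl a u v w : q (a *: u + v) w = a * q u w + q v w by apply: p_linr.
have q_linr a u v w : q u (a *: v + w) = a * q u v + q u w by apply: p_linl.
have [C maxC] := maximal_chain_exists p k.
pose l := dual_ops p k; pose D := dual_chain p C.
have l_gl : incl l (inGl q) by apply: dual_ops_gl.
have maxD : maximal_chain q l D by apply: dual_maximal_chain.
pose Fl := chain_flag p k C; pose Gl := chain_flag q l D.
have scF : semiclosedV p Fl by apply: chain_flag_semiclosed.
have scG : semiclosedV q Gl by apply: chain_flag_semiclosed.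
exists Fl, Gl; split.
- split=> //.
  + move=> f [Gf fG] F FF.
    have [g [fg Gg]] := inGl_adjoint p_linl p_linr Gf.
    (* The perpendicular of [F] is that of its closure, a member of [C]; it therefore lies in the
       chain [D], which every stabilizer of [Gl] preserves. *)
    apply/(stabW_adjoint p_linr p_ndr _ fg); rewrite -perpV_biperp.
    have gG G : Gl G -> stabV g G.
      by move=> GG; exact/(stabW_adjoint p_linr p_ndr _ fg)/(fG G GG).
    have := chain_flag_stabV q_linl maxD (inGl_lin q_linl Gg) gG.
    apply; exists (biperp p F); split=> //; exact: (chain_flag_biperp p_linl p_linr k_gl maxC FF).
  + move=> f [Gf fF] G GG.
    apply: (chain_flag_stabV p_linl maxC (inGl_lin p_linl Gf) fF).
    have <- : perpW p (biperp q G) = perpW p G := perpV_biperp q G.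
    apply: (dual_chain_perpW maxC).
    exact: (chain_flag_biperp q_linl q_linr l_gl maxD GG).
- move=> f kf; split; split; try exact: k_gl.
    by move=> F FF; apply: (chain_flag_stable maxC FF kf).
  move=> G GG; apply: (dual_ops_stable p_linl p_linr p_ndr k_gl G).1 kf.
  exact: (chain_flag_stable maxD GG).
- exact: chain_flag_irred.
- move=> G1 G2 G12 cl.
  have [G12i stG simple] := chain_flag_irred q_linl q_linr p_ndr l_gl maxD G12 cl.
  have stW B := dual_ops_stable p_linl p_linr p_ndr k_gl B.
  split=> //.
    move=> f kf; split; apply: (stW _).1 kf => g lg; by case: (stG g lg).
  by move=> M sM G1M MG2 stM; apply: simple => //; apply/stW.
Qed.

(** Sections irreducible under [k] stay irreducible under the larger [L]. This treats [L = k] and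
    the full stabilizer at once. *)
Lemma nilradical_sub (k L R : End V -> Prop) Fl Gl f :
  semiclosedV p Fl -> lieSub L -> incl k L -> incl L (St p Fl Gl) ->
  (forall F1 F2, isPair Fl F1 F2 -> closedV p F1 -> irredV k F1 F2) ->
  ideal L R -> locSolv R -> R f -> nilpEnd f -> St_nil p Fl Gl f.
Proof.
move=> [[sFl _ _ _] _] lieL kL LSt irrk idR lsR Rf nilf.
have [RL _ _] := idR; have Lf := RL _ Rf; split; first exact: LSt.
move=> F1 F2 F12 cl u F2u; have [FF1 FF2 _ _] := F12.
have [F12s _ simple] := irrk _ _ F12 cl.
have irrL : irredV L F1 F2.
  split=> // [h /LSt[[_ hF] _]|M sM F1M MF2 stM]; first by split; apply: hF.
  by apply: simple => // h /kL; apply: stM.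
have L_gl h : L h -> inGl p h by move=> /LSt /St_gl.
apply: (@locSolv_nilpotent_trivial _ _ L R F1 F2 _ _ lieL idR lsR _ _ irrL f) => //.
- by move=> h /L_gl; apply: inGl_lin.
- by move=> h /L_gl; apply: inGl_finrank.
- exact: sFl.
- exact: sFl.
Qed.

End Couple.

Theorem theorem3p7 (K : numClosedFieldType) (V W : lmodType K) (p : V -> W -> K)
  (p_linl : forall (a : K) (u v : V) (w : W), p (a *: u + v) w = a * p u w + p v w)
  (p_linr : forall (a : K) (u : V) (w z : W), p u (a *: w + z) = a * p u w + p u z)
  (p_ndl : forall u : V, (forall w, p u w = 0) -> u = 0)
  (p_ndr : forall w : W, (forall u, p u w = 0) -> w = 0)
  (cV : countable_dim V) (cW : countable_dim W)
  (k : End V -> Prop) (hk : subalg p k) :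
  exists (Fl : (V -> Prop) -> Prop) (Gl : (W -> Prop) -> Prop),
    [/\ taut p Fl Gl,
        (forall f, k f -> StV p Fl f /\ StW p Gl f),
        (forall F1 F2, isPair Fl F1 F2 -> closedV p F1 -> irredV k F1 F2),
        (forall G1 G2, isPair Gl G1 G2 -> closedW p G1 -> irredW p k G1 G2)
      & forall R R' : End V -> Prop,
          largestLS k R -> largestLS (fun f => StV p Fl f /\ StW p Gl f) R' ->
          forall f, (R f /\ nilpEnd f) <-> (R' f /\ nilpEnd f /\ k f)].
Proof.
have [k_gl lie_k] := hk.
have [Fl [Gl [tautFG kSt irrF irrG]]] := irreducible_couple p_linl p_linr p_ndl p_ndr k_gl.
have [scF scG _ _] := tautFG.
have [[sFl _ _ _] _] := scF; have [[sGl _ _ _] _] := scG.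
exists Fl, Gl; split=> // R R' [idR lsR maxR] [idR' lsR' maxR'] f.
pose N := St_nil p Fl Gl.
have idN : ideal (St p Fl Gl) N by apply: St_nil_ideal.
have lsN : locSolv N by apply: St_nil_locSolv.
have lieSt : lieSub (St p Fl Gl) by apply: St_lieSub.
split=> [[Rf nf]|[R'f [nf kf]]].
  (* With [L = k] the element lies in N, which the largest locally solvable ideal [R'] contains. *)
  have Nf : N f by apply: (nilradical_sub p_linl scF lie_k _ kSt irrF idR lsR Rf nf).
  split; first exact: (maxR' N).
  by split=> //; case: idR => Rk _ _; apply: Rk.
have Nf : N f by apply: (nilradical_sub p_linl scF lieSt kSt _ irrF idR' lsR' R'f nf).
(* The intersection of N and [k] is a locally solvable ideal of [k], hence inside [R]. *)
split=> //; apply: (maxR (fun h => N h /\ k h)) => //.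
  have [_ [N0 ND] NB] := idN; have [[k0 kD] kB] := lie_k; split; first by move=> h [].
    by split=> [//|a g h [Ng kg] [Nh kh]]; split; [apply: ND|apply: kD].
  by move=> g h kg [Nh kh]; split; [apply: NB => //; apply: kSt|apply: kB].
by apply: locSolv_sub lsN => h [].
Qed.
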